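(* Let $\{x^k\}_k$, $\{z^k\}_k$ be generated by the normal map-based stochastic proximal gradient method described in the context and assume conditions (A.1)–(A.4) hold. Then there exists a random variable $\psi^*:\Omega\to\mathbb{R}$ such that, as $k\to\infty$, \[ F^\lambda_{\mathrm{nor}}(z^k)\to0,\qquad F^\lambda_{\mathrm{nat}}(x^k)\to0,\qquad \psi(x^k)\to\psi^* \] almost surely on the event $\mathcal L=\{\omega: L(\omega)<\infty\}$.
   Context: Let $\varphi:\mathbb{R}^d\to(-\infty,\infty]$ be convex, lower semicontinuous and proper, let $f:\mathbb{R}^d\to\mathbb{R}$ be continuously differentiable on an open set containing $\mathrm{dom}\,\varphi$, and set $\psi=f+\varphi$. For $\lambda>0$ let $\mathrm{prox}_{\lambda\varphi}(x)=\operatorname{argmin}_y\{\varphi(y)+\frac{1}{2\lambda}\|x-y\|^2\}$, $\mathrm{env}_{\lambda\varphi}$ the Moreau envelope with $\nabla\mathrm{env}_{\lambda\varphi}(x)=(x-\mathrm{prox}_{\lambda\varphi}(x))/\lambda$, the normal map $F^\lambda_{\mathrm{nor}}(z)=\nabla f(\mathrm{prox}_{\lambda\varphi}(z))+\frac1\lambda(z-\mathrm{prox}_{\lambda\varphi}(z))$ and the natural residual $F^\lambda_{\mathrm{nat}}(x)=x-\mathrm{prox}_{\lambda\varphi}(x-\lambda\nabla f(x))$. Method: on a filtered probability space $(\Omega,\mathcal F,\{\mathcal F_k\}_k,\mathbb P)$, with $\lambda>0$, step sizes $\alpha_k>0$, deterministic $z^0$, $x^0=\mathrm{prox}_{\lambda\varphi}(z^0)$,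 and $\mathcal F_{k+1}$-measurable random vectors $g^k$, set $z^{k+1}=z^k-\alpha_k(g^k+\nabla\mathrm{env}_{\lambda\varphi}(z^k))$, $x^{k+1}=\mathrm{prox}_{\lambda\varphi}(z^{k+1})$. Let $e^k=g^k-\nabla f(x^k)$. $L(\omega)=\sup_{\bar x\in\mathrm{cl}(\mathrm{conv}\{x^k(\omega)\}_k)}\mathrm{lip}\,\nabla f(\bar x)$ with $\mathrm{lip}\,\nabla f(\bar x)=\limsup_{x,x'\to\bar x,\,x\ne x'}\|\nabla f(x)-\nabla f(x')\|/\|x-x'\|$. Conditions: (A.1) There is $\bar\psi\in\mathbb R$ with $\psi(x)\ge\bar\psi$ for all $x\in\mathrm{dom}\,\varphi$. (A.2) $\mathbb E[g^k\mid\mathcal F_k]=\nabla f(x^k)$ a.s. and there is $\{\sigma_k\}_k\subseteq\mathbb R_+$ with $\mathbb E[\|e^k\|^2]\le\sigma_k^2$ for all $k$. (A.3) $\sum_k\alpha_k=\infty$ and $\alpha_k\to0$. (A.4) There is a positive sequence $\{\beta_k\}_k$, non-decreasing for all $k$ sufficiently large, with $\sum_k\alpha_k^2\beta_k^2\sigma_k^2<\infty$. *)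

(* Defs.v *)
From HB Require Import structures.
From mathcomp Require Import all_boot all_order all_algebra.
From mathcomp Require Import all_classical all_reals all_analysis.
Set Implicit Arguments. Unset Strict Implicit. Unset Printing Implicit Defensive.
Import Order.TTheory GRing.Theory Num.Theory.
Import numFieldNormedType.Exports.
Local Open Scope classical_set_scope.
Local Open Scope ring_scope.

Section Defs.
Variable R : realType.
Variable d : nat.
Notation V := 'rV[R]_d.

Definition dotp (u v : V) : R := \sum_(i < d) u ord0 i * v ord0 i.
Definition enorm (u : V) : R := Num.sqrt (dotp u u).

Definition econvex (phi : V -> \bar R) : Prop :=
  forall (x y : V) (t : R), 0 <= t -> t <= 1 ->
    (phi (t *: x + (1 - t) *: y)%R <= t%:E * phi x + (1 - t)%:E * phi y)%E.

Definition eproper (phi : V -> \bar R) : Prop :=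
  (forall x, phi x != -oo%E) /\ exists x, (phi x < +oo)%E.

Definition edom (phi : V -> \bar R) : set V := [set x | (phi x < +oo)%E].

Definition prox_obj (phi : V -> \bar R) (lam : R) (x y : V) : \bar R :=
  (phi y + ((enorm (x - y)) ^+ 2 / (2 * lam))%:E)%E.
Definition is_prox (phi : V -> \bar R) (lam : R) (x p : V) : Prop :=
  forall y, (prox_obj phi lam x p <= prox_obj phi lam x y)%E.
Definition prox (phi : V -> \bar R) (lam : R) (x : V) : V :=
  xget 0 [set p | is_prox phi lam x p].

(* gradient of the Moreau envelope *)
Definition grad_env (phi : V -> \bar R) (lam : R) (x : V) : V :=
  lam^-1 *: (x - prox phi lam x).

Definition grad (f : V -> R) (x : V) : V :=
  \row_(i < d) ('D_(delta_mx ord0 i) f x).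

Definition C1_on (f : V -> R) (U : set V) : Prop :=
  open U /\ forall x, U x -> differentiable f x /\ {for x, continuous (grad f)}.

Definition Fnor (f : V -> R) (phi : V -> \bar R) (lam : R) (z : V) : V :=
  grad f (prox phi lam z) + lam^-1 *: (z - prox phi lam z).
Definition Fnat (f : V -> R) (phi : V -> \bar R) (lam : R) (x : V) : V :=
  x - prox phi lam (x - lam *: grad f x).

(* lip g xbar = limsup_{x,x' -> xbar, x <> x'} ||g x - g x'|| / ||x - x'||
   (infimum over radii r > 0 of the supremum of the quotients on the r-ball) *)
Definition lip (g : V -> V) (xbar : V) : \bar R :=
  ereal_inf [set ereal_sup
      [set ((enorm (g p.1 - g p.2) / enorm (p.1 - p.2))%:E)%E
       | p in [set p : V * V | enorm (p.1 - xbar) < r /\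
                               enorm (p.2 - xbar) < r /\ p.1 <> p.2]]
    | r in [set r : R | 0 < r]].

Definition conv_hull (S : set V) : set V :=
  [set y | exists (n : nat) (c : 'I_n -> R) (v : 'I_n -> V),
     (forall i, 0 <= c i) /\ \sum_(i < n) c i = 1 /\
     (forall i, S (v i)) /\ y = \sum_(i < n) c i *: v i].
End Defs.

Section Prob.
Context {dO : measure_display} {Omega : measurableType dO} {R : realType}.
Variable P : probability Omega R.
Variable d : nat.
Notation V := 'rV[R]_d.

Definition sub_sigma (G : set (set Omega)) : Prop :=
  sigma_algebra setT G /\ G `<=` measurable.

Definition filtration (Fk : nat -> set (set Omega)) : Prop :=
  forall k, sub_sigma (Fk k) /\ Fk k `<=` Fk k.+1.

Definition meas_wrt (G : set (set Omega)) (h : Omega -> V) : Prop :=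
  forall (i : 'I_d) (B : set R), measurable B ->
    G ((fun w => h w ord0 i) @^-1` B).

Definition cond_exp_eq (G : set (set Omega)) (Y Z : Omega -> V) : Prop :=
  meas_wrt G Z /\
  forall i : 'I_d,
    P.-integrable setT (fun w => ((Y w - Z w) ord0 i)%:E) /\
    forall A, G A -> (\int[P]_(w in A) ((Y w - Z w) ord0 i)%:E = 0)%E.
End Prob.

(* Main.v *)
Require Import Defs.
From HB Require Import structures.
From mathcomp Require Import all_boot all_order all_algebra.
From mathcomp Require Import all_classical all_reals all_analysis.
From mathcomp Require Import measurable_realfun ring lra.
Import Order.TTheory GRing.Theory Num.Theory.
Import numFieldNormedType.Exports.
Local Open Scope classical_set_scope.
Local Open Scope ring_scope.

(** Cut the iterations into consecutive blocks of total step size close to a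
    small T.  Since the step sizes are deterministic, so are the blocks, and
    Doob's L2 inequality on each of them shows that, almost surely, the squares
    of the block-wise maxima of the noise sums are summable; this holds
    simultaneously for all T = 1/(l+1).  Now fix a sample path with
    L(omega) < oo: the gradient is Lipschitz along the segments joining
    iterates, so for T small enough the merit function
    psi(x) + tau * lam / 2 * |F_nor(z)|^2 decreases over a block by a multiple
    of |F_nor|^2, up to a multiple of the squared noise maximum of the block.
    Summing over blocks gives F_nor -> 0 and the convergence of psi, and F_nat
    is bounded by lam * |F_nor| because the proximity operator is
    nonexpansive. *)

Set Implicit Arguments.
Unset Strict Implicit.

(** The obstacle is that the Lipschitz modulus is finite only path by path; it is not assumed
    bounded or integrable, so the merit function is not handled by supermartingale arguments.
    Probability therefore touches only step sizes and noise, and everything that involves the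
    gradient is deterministic. How short a block must be depends on the random modulus, which is why
    a countable family of lengths is prepared in advance, off a single null set. Blocks are needed
    because Young's inequality costs s^2 / S for a noise sum of size s over total step size S. For a
    single step this is alpha |e|^2, which need not be summable; over a block the divisor is about
    T. The merit function is needed because psi by itself only controls the displacement of x, which
    may vanish while F_nor does not: the proximity operator can be constant near z. Since z moves
    along -F_nor, the squared residual contributes the missing -|F_nor|^2, and a small tau keeps its
    cross terms below the decrease of psi. *)

(** * Euclidean inner product and norm, compared with the sup norm that carries the topology *)

Section EuclideanNorm.
Variables (R : realType) (d : nat).
Implicit Types (u v w : 'rV[R]_d).

Lemma dotpC u v : dotp u v = dotp v u.
Proof. by apply: eq_bigr => i _; rewrite mulrC. Qed.

Lemma dotpDl u v w : dotp (u + v) w = dotp u w + dotp v w.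
Proof.
by rewrite /dotp -big_split; apply: eq_bigr => i _; rewrite mxE mulrDl.
Qed.

Lemma dotpZl a u v : dotp (a *: u) v = a * dotp u v.
Proof.
by rewrite /dotp mulr_sumr; apply: eq_bigr => i _; rewrite mxE mulrA.
Qed.

Lemma dotpNl u v : dotp (- u) v = - dotp u v.
Proof. by rewrite -scaleN1r dotpZl mulN1r. Qed.

Lemma dotpDr u v w : dotp u (v + w) = dotp u v + dotp u w.
Proof. by rewrite !(dotpC u) dotpDl. Qed.

Lemma dotpZr a u v : dotp u (a *: v) = a * dotp u v.
Proof. by rewrite !(dotpC u) dotpZl. Qed.

Lemma dotpNr u v : dotp u (- v) = - dotp u v.
Proof. by rewrite !(dotpC u) dotpNl. Qed.

Definition dotpE := (dotpDl, dotpDr, dotpNl, dotpNr, dotpZl, dotpZr).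

Lemma dotpp_ge0 u : 0 <= dotp u u.
Proof. by apply: sumr_ge0 => i _; rewrite -expr2 sqr_ge0. Qed.

Lemma enorm_ge0 u : 0 <= enorm u.
Proof. exact: sqrtr_ge0. Qed.

Lemma enorm_sqr u : enorm u ^+ 2 = dotp u u.
Proof. by rewrite sqr_sqrtr // dotpp_ge0. Qed.

Lemma coord_le_enorm u i : `|u ord0 i| <= enorm u.
Proof.
rewrite -sqrtr_sqr ler_wsqrtr // /dotp (bigD1 i) //= expr2 lerDl.
by apply: sumr_ge0 => j _; rewrite -expr2 sqr_ge0.
Qed.

Lemma normr_le_enorm u : `|u| <= enorm u.
Proof.
change (mx_norm u <= enorm u); rewrite mx_normrE.
apply: bigmax_le => [|[i j] _]; first exact: enorm_ge0.
by rewrite (ord1 i); exact: coord_le_enorm.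
Qed.

Lemma coord_le_normr u i : `|u ord0 i| <= `|u|.
Proof.
change (`|u ord0 i| <= mx_norm u); rewrite mx_normrE.
by rewrite (le_bigmax _ (fun i => `|u i.1 i.2|) (ord0, i)).
Qed.

Lemma enorm_eq0 u : enorm u = 0 -> u = 0.
Proof.
move=> u0; apply/eqP; rewrite -normr_eq0 eq_le normr_ge0 andbT -u0.
exact: normr_le_enorm.
Qed.

Lemma enormN u : enorm (- u) = enorm u.
Proof. by rewrite /enorm !dotpE opprK. Qed.

Lemma enorm0 : enorm (0 : 'rV[R]_d) = 0.
Proof. by rewrite /enorm -(scale0r 0) dotpZl mul0r sqrtr0. Qed.

Lemma enormZ a u : enorm (a *: u) = `|a| * enorm u.
Proof.
by rewrite /enorm !dotpE mulrA -expr2 sqrtrM ?sqr_ge0// sqrtr_sqr.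
Qed.

Lemma enorm_distC u v : enorm (u - v) = enorm (v - u).
Proof. by rewrite -enormN opprB. Qed.

Lemma dotp_le_enorm u v : dotp u v <= enorm u * enorm v.
Proof.
have [u0|u0] := eqVneq (enorm u) 0.
  by rewrite u0 mul0r (enorm_eq0 u0) -(scale0r 0) dotpZl mul0r.
have [v0|v0] := eqVneq (enorm v) 0.
  by rewrite v0 mulr0 (enorm_eq0 v0) -(scale0r 0) dotpZr mul0r.
have ug : 0 < enorm u by rewrite lt_def u0 enorm_ge0.
have vg : 0 < enorm v by rewrite lt_def v0 enorm_ge0.
have := dotpp_ge0 (enorm v *: u - enorm u *: v).
rewrite !dotpE -!enorm_sqr (dotpC v u).
move=> h; have : 0 <= 2 * (enorm u * enorm v) * (enorm u * enorm v - dotp u v).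
  by apply: le_trans h _; rewrite le_eqVlt; apply/orP; left; apply/eqP; ring.
by rewrite pmulr_rge0 ?subr_ge0// !mulr_gt0.
Qed.

Lemma enorm_sqrD u v :
  enorm (u + v) ^+ 2 = enorm u ^+ 2 + 2 * dotp u v + enorm v ^+ 2.
Proof. by rewrite !enorm_sqr !dotpE (dotpC v u); ring. Qed.

Lemma enorm_sqrB u v :
  enorm (u - v) ^+ 2 = enorm u ^+ 2 - 2 * dotp u v + enorm v ^+ 2.
Proof. by rewrite enorm_sqrD dotpNr enormN mulrN. Qed.

Lemma ler_enormD u v : enorm (u + v) <= enorm u + enorm v.
Proof.
rewrite -(@ler_pXn2r _ 2) ?nnegrE ?addr_ge0 ?enorm_ge0// enorm_sqrD.
by have := dotp_le_enorm u v; nra.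
Qed.

Lemma ler_enormB u v : enorm (u - v) <= enorm u + enorm v.
Proof. by rewrite (le_trans (ler_enormD _ _))// enormN. Qed.

Lemma ler_enorm_sum (I : Type) (r : seq I) (Q : pred I) (F : I -> 'rV[R]_d) :
  enorm (\sum_(i <- r | Q i) F i) <= \sum_(i <- r | Q i) enorm (F i).
Proof.
elim/big_ind2 : _ => [|x y x' y' h h'|//]; first by rewrite enorm0.
by rewrite (le_trans (ler_enormD _ _))// lerD.
Qed.

Lemma enorm_le_normr u : enorm u <= d%:R * `|u|.
Proof.
have -> : d%:R * `|u| = \sum_(i < d) `|u|.
  by rewrite sumr_const card_ord mulr_natl.
rewrite -(@ler_pXn2r _ 2) ?nnegrE ?enorm_ge0//; last first.
  by apply: sumr_ge0.
rewrite enorm_sqr expr2 mulr_suml; apply: ler_sum => i _.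
have [h1 h2] : `|u ord0 i| <= `|u| /\ `|u| <= \sum_(j < d) `|u|.
  split; first exact: coord_le_normr.
  by rewrite (bigD1 i)//= lerDl sumr_ge0.
by rewrite (le_trans (ler_norm _))// normrM ler_pM// (le_trans h1).
Qed.

Lemma continuous_enorm : continuous (@enorm R d).
Proof.
move=> u; apply/(@cvgrPdist_le _ _ _ (nbhs u) _) => e e0.
near=> v.
have h : `|enorm u - enorm v| <= enorm (u - v).
  rewrite ler_norml lerBDr lerBlDr.
  have := ler_enormD (u - v) v; have := ler_enormD (v - u) u.
  by rewrite !subrK (enorm_distC v u) => h1 h2; apply/andP; split; lra.
rewrite (le_trans h)// (le_trans (enorm_le_normr _))//.
(* [d.+1] instead of [d] keeps the division legitimate in dimension zero. *)
rewrite (@le_trans _ _ (d.+1%:R * `|u - v|)) ?ler_wpM2r ?ler_nat//.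
rewrite -ler_pdivlMl ?ltr0n//.
near: v; apply: cvgr_dist_le => //.
by rewrite mulr_gt0 ?invr_gt0 ?ltr0n.
Unshelve. all: by end_near. Qed.

Lemma cvg_enorm (u_ : nat -> 'rV[R]_d) (b_ : nat -> R) :
  (\forall k \near \oo, enorm (u_ k) <= b_ k) -> b_ @ \oo --> 0 ->
  u_ @ \oo --> (0 : 'rV[R]_d).
Proof.
move=> ub b0; apply/cvgr0Pnorm_le => e e0; near=> k.
rewrite (le_trans (normr_le_enorm _))// (@le_trans _ _ (b_ k))//.
  by near: k.
apply: le_trans (ler_norm _) _; near: k.
by move/cvgr0Pnorm_le : b0; exact.
Unshelve. all: by end_near. Qed.

End EuclideanNorm.

(** * Minimisation of lower semicontinuous functions on compact sets *)

Section LowerSemicontinuity.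
Variables (R : realType) (T : topologicalType).

(** The sublevel sets of [h] at its values on [K] are nested and generate a proper filter on [K]. A
    cluster point [p] is a minimiser: if h y < h p, the set where h > h y would be a neighbourhood
    of [p] that misses the sublevel set of [y]. *)
Lemma lower_semicontinuous_min (h : T -> \bar R) (K : set T) :
  lower_semicontinuous h -> (forall y, h y != -oo%E) -> compact K ->
  K !=set0 -> exists2 p, K p & forall y, K y -> (h p <= h y)%E.
Proof.
move=> lsch hN cK [k0 Kk0].
pose B y := K `&` [set u | (h u <= h y)%E].
have PF : ProperFilter (filter_from K B).
  apply: filter_from_proper; last by move=> y Ky; exists y; split=> /=.
  apply: filter_from_filter; first by exists k0.
  move=> i j Ki Kj; case/orP: (le_total (h i) (h j)) => hij.
    by exists i => // u [Ku ui]; split; split => //=; exact: le_trans hij.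
  by exists j => // u [Ku ui]; split; split => //=; exact: le_trans hij.
have [|p [Kp clp]] := cK _ PF; first by exists k0 => // u [].
exists p => // y Ky; rewrite leNgt; apply/negP => hyp.
have hyfin : h y \is a fin_num.
  by rewrite fin_numE hN; apply/eqP => hy; move: hyp; rewrite hy ltNge leey.
have [|W nW hW] := lsch p (fine (h y)); first by rewrite fineK.
have [u [[_ /= uy] Wu]] : (B y `&` W) !=set0 by apply: clp => //; exists y.
by have := hW _ Wu; rewrite fineK// ltNge uy.
Qed.

Lemma lower_semicontinuousDr (h : T -> \bar R) (q : T -> R) :
  lower_semicontinuous h -> (forall y, h y != -oo%E) -> continuous q ->
  lower_semicontinuous (fun y => h y + (q y)%:E)%E.
Proof.
move=> lsch hN cq p a ap.
have [b bp abq] : exists2 b : R, (b%:E < h p)%E & a - b < q p.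
  case hp : (h p) ap (hN p) => [r| |]// ap _.
    move: ap; rewrite -EFinD lte_fin => ap.
    by exists ((r + a - q p) / 2); rewrite ?lte_fin; lra.
  by exists (a - q p + 1); rewrite ?ltry//; lra.
have [W nW hW] := lsch _ _ bp.
exists (W `&` [set y | a - b < q y]).
  apply: filterI => //.
  exact: (cvgr_gt (q p) (cq p)).
move=> y [/hW hy /= ay]; case: (h y) hy (hN y) => [r| |]//.
  by rewrite -EFinD !lte_fin => ? _; lra.
by move=> _ _; rewrite addye// ltry.
Qed.

End LowerSemicontinuity.

(** * The proximity operator: existence, subgradient inequality, firm nonexpansiveness *)

Section Prox.
Variables (R : realType) (d : nat).
Notation V := 'rV[R]_d.

Lemma continuous_enormB (x : V) : continuous (fun y : V => enorm (x - y)).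
Proof.
move=> y; apply: (@continuous_comp V V R (fun y : V => x - y) (@enorm R d)).
  by apply: continuousB; [exact: cst_continuous|exact: cvg_id].
exact: continuous_enorm.
Qed.

Lemma compact_enorm_ball (x : V) (r : R) : compact [set y | enorm (x - y) <= r].
Proof.
apply: bounded_closed_compact.
  exists (enorm x + r); split; first exact: num_real.
  move=> M xM y /= yr; rewrite (le_trans (normr_le_enorm _))//.
  rewrite (le_trans _ (ltW xM))//.
  have -> : y = x - (x - y) by rewrite opprB addrC subrK.
  by rewrite (le_trans (ler_enormB _ _))// lerD2l.
have /continuous_closedP := @continuous_enormB x.
by move=> /(_ _ (@closed_le R r)).
Qed.

Variables (phi : V -> \bar R) (lam : R).
Hypotheses (cphi : econvex phi) (lscphi : lower_semicontinuous phi).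
Hypotheses (pphi : eproper phi) (lam0 : 0 < lam).

Let phiN y : phi y != -oo%E := pphi.1 y.

(** A linear lower bound on growth, obtained without separating hyperplanes: [m] is the minimum of
    [phi] on the unit ball around [x0], and convexity on the ray from [x0] through [y] carries the
    bound from the unit sphere outwards with slope at most c - m. *)
Lemma econvex_minorant : exists x0 a b, 0 <= b /\ phi x0 \is a fin_num /\
  forall y, ((a - b * enorm (y - x0))%:E <= phi y)%E.
Proof.
have [x0 x0dom] := pphi.2.
have x0fin : phi x0 \is a fin_num by rewrite fin_numE phiN lt_eqF.
have [|p /= p1 pmin] := lower_semicontinuous_min lscphi phiN (@compact_enorm_ball x0 1).
  by exists x0; rewrite /= subrr enorm0.
have px0 : (phi p <= phi x0)%E by apply: pmin; rewrite /= subrr enorm0.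
have pfin : phi p \is a fin_num.
  by rewrite fin_numE phiN lt_eqF// (le_lt_trans px0).
move: px0; rewrite -(fineK pfin) -(fineK x0fin) lee_fin => px0.
set m := fine (phi p) in px0 *; set c := fine (phi x0) in px0 *.
exists x0, m, (c - m); rewrite subr_ge0; split=> //; split => // y.
have [y1|y1] := leP (enorm (y - x0)) 1.
  apply: (@le_trans _ _ m%:E).
    by rewrite lee_fin gerBl mulr_ge0 ?subr_ge0 ?enorm_ge0.
  by rewrite fineK// pmin//= enorm_distC.
have n0 : 0 < enorm (y - x0) by apply: lt_trans y1.
have t0 : 0 < (enorm (y - x0))^-1 by rewrite invr_gt0.
have t1 : (enorm (y - x0))^-1 <= 1 by rewrite invf_le1 ?ltW.
have := cphi y x0 (ltW t0) t1.
have : (m%:E <= phi ((enorm (y - x0))^-1 *: y + (1 - (enorm (y - x0))^-1) *: x0))%E.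
  rewrite fineK//; apply: pmin => /=.
  have -> : x0 - ((enorm (y - x0))^-1 *: y + (1 - (enorm (y - x0))^-1) *: x0) =
            (enorm (y - x0))^-1 *: (x0 - y).
    by apply/rowP => i; rewrite !mxE; ring.
  by rewrite enormZ gtr0_norm// (enorm_distC x0) mulVf// gt_eqF.
move=> /le_trans h /h; case: (phi y) (phiN y) => [r| |]// _; last by rewrite leey.
rewrite -(fineK x0fin) -/c -!EFinM -EFinD !lee_fin => {}h.
have {}h : enorm (y - x0) * m <= r + (enorm (y - x0) - 1) * c.
  have -> : r + (enorm (y - x0) - 1) * c = enorm (y - x0) *
    ((enorm (y - x0))^-1 * r + (1 - (enorm (y - x0))^-1) * c).
    by field; rewrite gt_eqF.
  by rewrite ler_pM2l.
move: px0 h; clear; move: (enorm _) => n; clearbody m c => h1 h2. nra.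
Qed.

Lemma is_prox_exists x : exists p, is_prox phi lam x p.
Proof.
have [x0 [a [b [b0 [x0fin hab]]]]] := econvex_minorant.
pose q y : R := enorm (x - y) ^+ 2 / (2 * lam).
pose h y : \bar R := (phi y + (q y)%:E)%E.
have cq : continuous q.
  move=> y; apply: (@continuous_comp V R R (fun y : V => enorm (x - y))
    (fun t => t ^+ 2 / (2 * lam))); first exact: continuous_enormB.
  by apply: continuousM; [exact: exprn_continuous|exact: cst_continuous].
have hN y : h y != -oo%E by rewrite /h; case: (phi y) (phiN y).
have lsch : lower_semicontinuous h by exact: lower_semicontinuousDr.
pose v := fine (phi x0) + q x0.
have hx0 : h x0 = v%:E by rewrite /h -(fineK x0fin) -EFinD.
pose D := enorm (x - x0).
(* Outside radius [rho] the first summand makes the quadratic at least (b + 1) |x - y|, which beats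
   the minorant with |x - y| to spare; the second makes that surplus exceed the value at [x0]; the
   third puts [x0] in the ball. *)
pose rho := 2 * lam * (b + 1) + `|v - a + b * D| + D.
have D0 : 0 <= D := enorm_ge0 _.
have x0in : enorm (x - x0) <= rho.
  rewrite -/D /rho lerDr addr_ge0// !mulr_ge0// ?ltW//; lra.
have [|p /= prho pmin] := lower_semicontinuous_min lsch hN (@compact_enorm_ball x rho).
  by exists x0.
exists p => y; rewrite /prox_obj -/(q p) -/(q y) -/(h p) -/(h y).
have [yrho|yrho] := leP (enorm (x - y)) rho; first exact: pmin.
apply: le_trans (pmin _ x0in) _; rewrite hx0.
apply: (@le_trans _ _ ((a - b * enorm (y - x0))%:E + (q y)%:E)%E); last first.
  by rewrite leeD2r.
rewrite -EFinD lee_fin.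
have tri : enorm (y - x0) <= enorm (x - y) + D.
  rewrite (enorm_distC x y); apply: le_trans (ler_enormD _ _).
  by rewrite addrA subrK.
have q1 : (b + 1) * enorm (x - y) <= q y.
  rewrite /q ler_pdivlMr ?mulr_gt0//.
  have h1 : 2 * lam * (b + 1) <= enorm (x - y).
    by apply: le_trans (ltW yrho); rewrite /rho -addrA lerDl addr_ge0.
  by have := ler_wpM2r (enorm_ge0 (x - y)) h1; lra.
have h2 : v - a + b * D <= enorm (x - y).
  apply: le_trans (ltW yrho); rewrite /rho; have := ler_norm (v - a + b * D).
  have : 0 <= 2 * lam * (b + 1) by rewrite !mulr_ge0// ?addr_ge0// ltW.
  lra.
have := ler_wpM2l b0 tri; move: (enorm (x - y)) (enorm (y - x0)) (q y) q1 h2 => *.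
lra.
Qed.

Notation prx := (prox phi lam).

Lemma prox_is_prox x : is_prox phi lam x (prx x).
Proof. by rewrite /prox; case: xgetP => // h; have [p /h] := is_prox_exists x. Qed.

Lemma prox_fin_num x : phi (prx x) \is a fin_num.
Proof.
have [x0 x0dom] := pphi.2; rewrite fin_numE phiN/=; apply/eqP => pinfty.
have := prox_is_prox x x0; rewrite /prox_obj pinfty addye// leye_eq.
by case: (phi x0) x0dom.
Qed.

(** Fermat's rule: (x - prox x) / lam is a subgradient at prox x. The minimality of p = prox x is
    tested at p + t (y - p); dividing by [t] leaves an error proportional to [t], which then tends
    to 0. *)
Lemma prox_subgradient x y :
  (phi (prx x) + (lam^-1 * dotp (x - prx x) (y - prx x))%:E <= phi y)%E.
Proof.
set p := prx x; have pfin := prox_fin_num x; rewrite -/p in pfin.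
have [[r hr]|yinf] : (exists r, phi y = r%:E) \/ phi y = +oo%E.
  by case: (phi y) (phiN y) => [r| |]// _; [left; exists r|right].
  2: by rewrite yinf leey.
rewrite hr -(fineK pfin) -EFinD lee_fin.
set c := fine (phi p); set D := dotp _ _; set E := enorm (y - p) ^+ 2.
have E0 : 0 <= E by rewrite /E exprn_ge0 ?enorm_ge0.
have key t : 0 < t -> t <= 1 -> c + lam^-1 * D <= r + t * (E / (2 * lam)).
  move=> t0 t1; have := prox_is_prox x (t *: y + (1 - t) *: p).
  rewrite -/p /prox_obj => /le_trans; move=> /(_ ((t%:E * phi y + (1 - t)%:E * phi p) +
     ((enorm (x - (t *: y + (1 - t) *: p)) ^+ 2 / (2 * lam))%:E))%E).
  rewrite leeD2r//; last by apply: cphi => //; exact: ltW.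
  move=> /(_ isT); rewrite hr -(fineK pfin) -/c -!EFinM -!EFinD lee_fin.
  have -> : x - (t *: y + (1 - t) *: p) = (x - p) - t *: (y - p).
    by apply/rowP => i; rewrite !mxE; ring.
  rewrite (enorm_sqrB (x - p)) dotpZr -/D enormZ exprMn gtr0_norm// -/E.
  move: (enorm (x - p) ^+ 2) => X.
  have -> : (X - 2 * (t * D) + t ^+ 2 * E) / (2 * lam) =
     X / (2 * lam) - t * (lam^-1 * D) + t * (t * (E / (2 * lam))).
    by field; rewrite gt_eqF.
  move: (X / _) (lam^-1 * D) (E / _) => X' D' E' h.
  by rewrite -(ler_pM2l t0); lra.
apply/ler_addgt0Pr => e e0.
pose K := E / (2 * lam) + 1.
have EK : 0 <= E / (2 * lam) by rewrite divr_ge0// mulr_ge0// ltW.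
have K0 : 0 < K by rewrite /K; lra.
pose t := Num.min 1 (e / K).
have t0 : 0 < t by rewrite lt_min ltr01 divr_gt0.
apply: le_trans (key t t0 _) _; first by rewrite ge_min lexx.
rewrite lerD2l; apply: (@le_trans _ _ (e / K * K)); last by rewrite divfK// gt_eqF.
apply: ler_pM => //; first exact: ltW.
  by rewrite ge_min lexx orbT.
by rewrite /K; lra.
Qed.

Lemma prox_subgradient_fine x x' : fine (phi (prx x)) +
  lam^-1 * dotp (x - prx x) (prx x' - prx x) <= fine (phi (prx x')).
Proof.
by rewrite -lee_fin EFinD !fineK ?prox_fin_num//; exact: prox_subgradient.
Qed.

(** Monotonicity of the subdifferential, as the sum of two subgradient inequalities. *)
Lemma prox_firm x y :
  enorm (prx x - prx y) ^+ 2 <= dotp (x - y) (prx x - prx y).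
Proof.
have := lerD (prox_subgradient_fine x y) (prox_subgradient_fine y x).
rewrite [leRHS]addrC addrACA gerDl.
rewrite -mulrDr pmulr_rle0 ?invr_gt0//.
rewrite -(opprB (prx x) (prx y)) dotpNr enorm_sqr !dotpE; lra.
Qed.

Lemma prox_nonexpansive x y : enorm (prx x - prx y) <= enorm (x - y).
Proof.
have [->|p0] := eqVneq (enorm (prx x - prx y)) 0; first exact: enorm_ge0.
rewrite -(@ler_pM2r _ (enorm (prx x - prx y))) ?lt_def ?p0 ?enorm_ge0//.
by rewrite -expr2 (le_trans (prox_firm x y))// dotp_le_enorm.
Qed.

Lemma coprox_nonexpansive x y :
  enorm ((x - prx x) - (y - prx y)) <= enorm (x - y).
Proof.
rewrite -(@ler_pXn2r _ 2) ?nnegrE ?enorm_ge0//.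
have -> : (x - prx x) - (y - prx y) = (x - y) - (prx x - prx y).
  by apply/rowP => i; rewrite !mxE; ring.
rewrite enorm_sqrB; have := prox_firm x y.
have := exprn_ge0 2 (enorm_ge0 (prx x - prx y)); lra.
Qed.

Lemma continuous_prox : continuous prx.
Proof.
move=> u; apply/(@cvgrPdist_le _ _ _ (nbhs u) _) => e e0; near=> v.
rewrite (le_trans (normr_le_enorm _))// (le_trans (prox_nonexpansive _ _))//.
rewrite (le_trans (enorm_le_normr _))//.
rewrite (@le_trans _ _ (d.+1%:R * `|u - v|)) ?ler_wpM2r ?ler_nat//.
rewrite -ler_pdivlMl ?ltr0n//.
near: v; apply: cvgr_dist_le => //.
by rewrite mulr_gt0 ?invr_gt0 ?ltr0n.
Unshelve. all: by end_near. Qed.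

End Prox.

(** * From the pointwise modulus [lip] to Lipschitz and descent estimates along segments *)

Section Segments.
Variables (R : realType) (d : nat).
Notation V := 'rV[R]_d.
Implicit Types (a b : V) (G : V -> V).

Lemma conv_hull_segment (S : set V) a b (t : R) :
  S a -> S b -> 0 <= t -> t <= 1 -> conv_hull S (a + t *: (b - a)).
Proof.
move=> Sa Sb t0 t1; exists 2%N, (fun i => if i == ord0 then 1 - t else t),
  (fun i => if i == ord0 then a else b).
split; first by move=> i; case: ifP; rewrite ?subr_ge0.
split; first by rewrite !big_ord_recl big_ord0 /= addr0 subrK.
split; first by move=> i; case: ifP.
rewrite !big_ord_recl big_ord0 /= addr0.
by apply/rowP => i; rewrite !mxE; ring.
Qed.

Lemma lip_lt_local G (y : V) (M : R) : 0 <= M -> (lip G y < M%:E)%E ->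
  exists2 r : R, 0 < r & forall p q, enorm (p - y) < r -> enorm (q - y) < r ->
    enorm (G p - G q) <= M * enorm (p - q).
Proof.
move=> M0 /ereal_inf_lt[_ /= [r r0 <-] supM]; exists r => // p q py qy.
have [->|/eqP pq] := eqVneq p q; first by rewrite !subrr enorm0 mulr0.
have pq0 : 0 < enorm (p - q).
  rewrite lt_def enorm_ge0 andbT; apply/eqP => /enorm_eq0/eqP.
  by rewrite subr_eq0 => /eqP.
rewrite -ler_pdivrMr// -lee_fin; apply: le_trans (ltW supM).
by apply: ereal_sup_ubound; exists (p, q).
Qed.

(* The set of t for which the Lipschitz bound holds on [a, a + t (b - a)] is
   closed under limits and can be prolonged, hence contains 1. *)
Lemma segment_lipschitz G a b (M : R) : 0 <= M ->
  (forall t : R, 0 <= t -> t <= 1 -> exists2 r : R, 0 < r &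
     forall p q, enorm (p - (a + t *: (b - a))) < r ->
       enorm (q - (a + t *: (b - a))) < r ->
       enorm (G p - G q) <= M * enorm (p - q)) ->
  enorm (G b - G a) <= M * enorm (b - a).
Proof.
move=> M0 locM; pose c (t : R) : V := a + t *: (b - a).
have cB t u : enorm (c t - c u) = `|t - u| * enorm (b - a).
  by rewrite -enormZ /c; congr enorm; apply/rowP => i; rewrite !mxE; ring.
pose A := [set t : R | 0 <= t /\ t <= 1 /\
  enorm (G (c t) - G a) <= M * (t * enorm (b - a))].
have A0 : A 0.
  by split => //; split => //; rewrite /c scale0r addr0 subrr enorm0 mul0r mulr0.
have supA : has_sup A by split; [exists 0|exists 1 => t [_ []]].
pose s := sup A.
have s0 : 0 <= s by apply: sup_ubound => //; case: supA.
have s1 : s <= 1 by apply: sup_le_ub => [|t [_ []]//]; exists 0.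
have [r r0 hr] := locM s s0 s1.
(* The radius [r] converted to the parameter scale; the [+ 1] covers a = b. *)
pose dl := r / (enorm (b - a) + 1).
have ba1 : 0 < enorm (b - a) + 1 by rewrite ltr_wpDl ?enorm_ge0.
have dl0 : 0 < dl by rewrite divr_gt0.
have near_s t : `|t - s| < dl -> enorm (c t - c s) < r.
  rewrite cB => ts; apply: (@le_lt_trans _ _ (`|t - s| * (enorm (b - a) + 1))).
    by rewrite ler_wpM2l// lerDl.
  by rewrite -ltr_pdivlMr.
have [t At st] := sup_adherent dl0 supA; rewrite -/s in st.
have ts : t <= s by apply: sup_ubound => //; case: supA.
(* [t] in [A] and [t'] past the supremum both lie in the Lipschitz ball around [c s], so the bound
   passes from [t] to [t']. Unless [t'] is capped at 1, it would be an element of [A] above its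
   supremum. *)
pose t' := Num.min 1 (s + dl / 2).
have st' : s <= t' by rewrite le_min s1 lerDl ltW// divr_gt0.
have t's : t' <= s + dl / 2 by rewrite ge_min lexx orbT.
have tt' : t <= t' by exact: le_trans st'.
have At' : A t'.
  case: At => t0 [t1 ht]; split; first exact: le_trans tt'.
  split; first by rewrite ge_min lexx.
  have -> : G (c t') - G a = (G (c t') - G (c t)) + (G (c t) - G a).
    by rewrite addrA subrK.
  apply: le_trans (ler_enormD _ _) _.
  have := hr (c t') (c t) (near_s t' _) (near_s t _).
  rewrite cB (ger0_norm (x := t' - t)) ?subr_ge0// => h.
  have {}h : enorm (G (c t') - G (c t)) <= M * ((t' - t) * enorm (b - a)).
    apply: h; first by rewrite ger0_norm ?subr_ge0//; move: t's dl0; lra.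
    by rewrite ler0_norm ?subr_le0//; move: st; lra.
  have -> : M * (t' * enorm (b - a)) =
      M * ((t' - t) * enorm (b - a)) + M * (t * enorm (b - a)) by ring.
  exact: lerD.
have t'1 : t' = 1.
  have [h|h] := leP 1 (s + dl / 2); first by rewrite /t' min_l.
  have : t' <= s by apply: sup_ubound => //; case: supA.
  by rewrite /t' (min_r (ltW h)); move: dl0 => + ?; lra.
by move: At' => [_ [_]]; rewrite t'1 /c scale1r mul1r [a + _]addrC subrK.
Qed.

Lemma derive_dotp_grad (f : V -> R) (x v : V) :
  differentiable f x -> 'D_v f x = dotp (grad f x) v.
Proof.
move=> df; rewrite deriveE// [in LHS](row_sum_delta v) linear_sum.
apply: eq_bigr => i _; rewrite linearZ /= mxE deriveE// mulrC.
by [].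
Qed.

(** The mean value theorem takes the place of integrating the gradient; the price is the constant
    [M] instead of M / 2. *)
Lemma segment_descent (f : V -> R) a b (M : R) : 0 <= M ->
  (forall t : R, 0 <= t -> t <= 1 -> differentiable f (a + t *: (b - a))) ->
  (forall t : R, 0 <= t -> t <= 1 ->
     enorm (grad f (a + t *: (b - a)) - grad f a) <= M * enorm (b - a)) ->
  f b - f a <= dotp (grad f a) (b - a) + M * enorm (b - a) ^+ 2.
Proof.
move=> M0 df gM; pose c (t : R) : V := a + t *: (b - a).
pose h t := f (c t).
have quot (t : R) : (fun s : R => s^-1 *: (h (s *: 1 + t) - h t)) =
              (fun s : R => s^-1 *: (f (s *: (b - a) + c t) - f (c t))).
  apply/funext => s; rewrite /h; congr (_ *: (f _ - _)).
  by rewrite /c; apply/rowP => i; rewrite !mxE /= [s *: 1]mulr1; ring.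
have dh (t : R) : 0 <= t -> t <= 1 ->
    is_derive t 1 h (dotp (grad f (c t)) (b - a)).
  move=> t0 t1; have dfc := df t t0 t1.
  apply: DeriveDef.
    rewrite /derivable; have -> := quot t.
    exact: diff_derivable.
  rewrite -derive_dotp_grad//.
  by transitivity (lim ((fun s : R => s^-1 *: (h (s *: 1 + t) - h t)) @ 0^'));
    [|rewrite quot].
have [||t] := @MVT_segment R h (fun t => dotp (grad f (c t)) (b - a)) 0 1 ler01.
- by move=> t; rewrite in_itv /= => /andP[t0 t1]; apply: dh; exact: ltW.
- apply: derivable_within_continuous => t; rewrite in_itv /= => /andP[t0 t1].
  by case: (dh t t0 t1).
rewrite in_itv /= => /andP[t0 t1]; rewrite /h /c scale1r scale0r addr0 [a + (b - a)]addrC subrK.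
rewrite subr0 mulr1 addrC => ->.
rewrite -lerBlDl -dotpNl -dotpDl; apply: le_trans (dotp_le_enorm _ _) _.
by rewrite expr2 mulrA ler_wpM2r ?enorm_ge0// gM.
Qed.

End Segments.

(** * The scalar inequality behind the decrease over one block *)

Section WindowAlgebra.
Variable R : realType.

Lemma sqr_le_2sqrD (r a b : R) : 0 <= r -> r <= a + b ->
  r ^+ 2 <= 2 * a ^+ 2 + 2 * b ^+ 2.
Proof.
move=> r0 rab; have : r ^+ 2 <= (a + b) ^+ 2.
  by rewrite ler_pXn2r// nnegrE// (le_trans r0).
by have := sqr_ge0 (a - b); nra.
Qed.

(* [a], [b], [c], [dd], [q1], [q2] stand for the inner products <F, dx>,
   <dz, dx>, <F, dz>, <F, dG>, <r, dx> and <F, r>, where dz = - S F + r. *)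
Lemma window_algebra (lam L K S tau F s X rho G a b c dd q1 q2 : R) :
  0 < lam -> 0 <= L -> K = L + lam^-1 -> 0 < S -> 0 < tau ->
  tau <= 1 / 4 -> tau * (lam * L) ^+ 2 <= 1 / 8 ->
  64 * (K * S) ^+ 2 <= tau -> 32 * lam * K ^+ 2 * S <= 1 ->
  0 <= F -> 0 <= s -> 0 <= X -> 0 <= rho -> 0 <= G ->
  c = - S * F ^+ 2 + q2 -> b = - S * a + q1 -> X ^+ 2 <= b ->
  dd <= F * (L * X) -> q1 <= rho * X -> q2 <= F * rho ->
  rho <= 2 * K * S ^+ 2 * F + 2 * s -> G <= 2 * K * (S * F + s) ->
  (a + lam^-1 * b - lam^-1 * X ^+ 2 + L * X ^+ 2) +
    tau * (lam * dd + c - a + lam / 2 * G ^+ 2) <=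
  - (tau * S / 4) * F ^+ 2 + 14 / S * s ^+ 2.
Proof.
move=> lam0 L0 KE S0 tau0 tau4 tauL KS lKS F0 s0 X0 rho0 G0.
move=> cE bE Xb ddle q1le q2le rhole Gle.
have lamV0 : 0 < lam^-1 by rewrite invr_gt0.
have K0 : 0 < K by rewrite KE ltr_wpDl.
have KS0 : 0 < K * S by rewrite mulr_gt0.
(* From 64 (K S)^2 <= tau <= 1/4. As K = L + 1/lam, both L S and S / lam inherit the bound. *)
have KS16 : K * S <= 1 / 16.
  by rewrite leNgt; apply/negP => h; nra.
have LS : L * S <= 1 / 16.
  by apply: le_trans KS16; rewrite ler_wpM2r ?(ltW S0)// KE lerDl ltW.
have lS : lam^-1 * S <= 1 / 16.
  by apply: le_trans KS16; rewrite ler_wpM2r ?(ltW S0)// KE lerDr.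
have SV0 : 0 < S^-1 by rewrite invr_gt0.
have SVS : S * S^-1 = 1 by rewrite mulfV// gt_eqF.
have LSV : L <= S^-1 / 16.
  by rewrite -(ler_pM2r S0) mulrAC mulVf ?gt_eqF//; lra.
have lSV : lam^-1 <= S^-1 / 16.
  by rewrite -(ler_pM2r S0) mulrAC mulVf ?gt_eqF//; lra.
(* Up to noise and drift, dz is -S F, so <F, dx> is -<dz, dx> / S, and <dz, dx> is at least X^2:
   this is the decrease of psi, of order X^2 / S. *)
have aE : a = S^-1 * q1 - S^-1 * b.
  by rewrite bE; field; rewrite gt_eqF.
have h1 : (1 - tau) * a + lam^-1 * b <=
    S^-1 * (rho * X) - ((1 - tau) * S^-1 - lam^-1) * X ^+ 2.
  have c0 : 0 <= (1 - tau) * S^-1 - lam^-1 by nra.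
  have t1 := ler_wpM2l c0 Xb.
  have rX : 0 <= S^-1 * (rho * X) by rewrite !mulr_ge0// ltW.
  have t2 : (1 - tau) * (S^-1 * q1) <= S^-1 * (rho * X).
    apply: (@le_trans _ _ ((1 - tau) * (S^-1 * (rho * X)))).
      by rewrite ler_wpM2l ?subr_ge0 ?ler_wpM2l ?(ltW SV0)//; lra.
    by rewrite ler_piMl//; lra.
  by rewrite aE; lra.
have h2 : S^-1 * (rho * X) <= S^-1 / 4 * X ^+ 2 + S^-1 * rho ^+ 2.
  have : 0 <= S^-1 * (X / 2 - rho) ^+ 2 by rewrite mulr_ge0 ?sqr_ge0// ltW.
  by rewrite sqrrB; lra.
have h3 : tau * (lam * dd) <= S^-1 / 4 * X ^+ 2 + tau * S / 8 * F ^+ 2.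
  have t1 : tau * (lam * dd) <= tau * (lam * (F * (L * X))).
    by rewrite !ler_pM2l.
  have t2 : 0 <= S^-1 * (X / 2 - S * tau * lam * L * F) ^+ 2.
    by rewrite mulr_ge0 ?sqr_ge0// ltW.
  have t3 : S^-1 * (X / 2 - S * tau * lam * L * F) ^+ 2 =
    S^-1 / 4 * X ^+ 2 - tau * (lam * (F * (L * X))) +
    tau * S * F ^+ 2 * (tau * (lam * L) ^+ 2) by field; rewrite gt_eqF.
  have t4 : 0 <= tau * S * F ^+ 2 by rewrite !mulr_ge0 ?sqr_ge0// ltW.
  by have := ler_wpM2l t4 tauL; lra.
have h4 : S^-1 * rho ^+ 2 <= tau * S / 8 * F ^+ 2 + 8 * S^-1 * s ^+ 2.
  have t1 := ler_wpM2l (ltW SV0) (sqr_le_2sqrD rho0 rhole).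
  have t2 : S^-1 * (2 * (2 * K * S ^+ 2 * F) ^+ 2 + 2 * (2 * s) ^+ 2) =
    S * F ^+ 2 / 8 * (64 * (K * S) ^+ 2) + 8 * S^-1 * s ^+ 2.
    by field; rewrite gt_eqF.
  have t4 : 0 <= S * F ^+ 2 / 8 by rewrite !mulr_ge0 ?sqr_ge0// ltW.
  by have := ler_wpM2l t4 KS; lra.
have h5 : tau * q2 <= tau * S / 4 * F ^+ 2 + 4 * S^-1 * s ^+ 2.
  have t1 : tau * q2 <= tau * (F * (2 * K * S ^+ 2 * F + 2 * s)).
    rewrite ler_pM2l// (le_trans q2le)// ler_wpM2l//.
  have t2 : 0 <= S^-1 * (S * F / 4 - 4 * s) ^+ 2.
    by rewrite mulr_ge0 ?sqr_ge0// ltW.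
  have t3 : S^-1 * (S * F / 4 - 4 * s) ^+ 2 =
     S * F ^+ 2 / 16 - 2 * F * s + 16 * S^-1 * s ^+ 2.
    by field; rewrite gt_eqF.
  have t4 : 0 <= 2 * S * F ^+ 2 by rewrite !mulr_ge0 ?sqr_ge0// ltW.
  have t5 := ler_wpM2l t4 KS16.
  have t6 : F * (2 * K * S ^+ 2 * F + 2 * s) <=
    S * F ^+ 2 * (1 / 8 + 1 / 16) + 16 * S^-1 * s ^+ 2 by lra.
  have t7 := ler_wpM2l (ltW tau0) t6.
  have t8 : 0 <= S^-1 * s ^+ 2 by rewrite mulr_ge0 ?sqr_ge0// ltW.
  have t9 : 0 <= tau * (S * F ^+ 2).
    by rewrite !mulr_ge0 ?sqr_ge0// ltW.
  have := ler_wpM2r t8 tau4; lra.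
have h6 : tau * (lam / 2 * G ^+ 2) <= tau * S / 8 * F ^+ 2 + S^-1 * s ^+ 2.
  have Gle' : G <= 2 * K * S * F + 2 * K * s by lra.
  have tl0 : 0 <= tau * (lam / 2) by rewrite !mulr_ge0// ltW// ?divr_gt0.
  have t1 := ler_wpM2l tl0 (sqr_le_2sqrD G0 Gle').
  have t2 : tau * (lam / 2) *
      (2 * (2 * K * S * F) ^+ 2 + 2 * (2 * K * s) ^+ 2) =
    tau * S * F ^+ 2 / 8 * (32 * lam * K ^+ 2 * S) +
    tau / 8 * S^-1 * s ^+ 2 * (32 * lam * K ^+ 2 * S).
    by field; rewrite gt_eqF.
  have t4 : 0 <= tau * S * F ^+ 2 / 8 by rewrite !mulr_ge0 ?sqr_ge0// ltW.
  have t5 : 0 <= tau / 8 * S^-1 * s ^+ 2.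
    by rewrite !mulr_ge0 ?sqr_ge0// ltW.
  have t6 := ler_wpM2l t4 lKS; have t7 := ler_wpM2l t5 lKS.
  have t8 : 0 <= S^-1 * s ^+ 2 by rewrite mulr_ge0 ?sqr_ge0// ltW.
  rewrite mulrA; apply: le_trans t1 _; rewrite t2; apply: le_trans (lerD t6 t7) _.
  have := ler_wpM2r t8 tau4; lra.
(* [h2] and [h3] each spend [S^-1 / 4] of the coefficient of [X ^+ 2]; with tau <= 1/4 and L S <=
   1/16 the rest is nonnegative. *)
have h7 : 0 <= ((1 - tau) * S^-1 - L - S^-1 / 2) * X ^+ 2.
  by rewrite mulr_ge0 ?sqr_ge0//; nra.
have t8 : 0 <= S^-1 * s ^+ 2 by rewrite mulr_ge0 ?sqr_ge0// ltW.
have t9 : 0 <= tau * S * F ^+ 2 by rewrite !mulr_ge0 ?sqr_ge0// ltW.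
(* In units of tau S F^2, the gain 1 from [c] pays 1/8, 1/8, 1/4, 1/8 in [h3] to [h6], leaving 3/8
   against the claimed 1/4. In units of s^2 / S, the costs 8, 4, 1 of [h4] to [h6] stay below 14. *)
by rewrite cE; lra.
Qed.

End WindowAlgebra.

(** * Real sequences: almost monotone convergence, and blocks of prescribed total step size *)

Section RealSequences.
Variable R : realType.

Lemma cvg_bounded_sum (a : nat -> R) (C : R) : (forall n, 0 <= a n) ->
  (forall n, \sum_(0 <= i < n) a i <= C) -> a @ \oo --> 0.
Proof.
move=> a0 aC; apply: cvg_series_cvg_0; apply: nondecreasing_is_cvgn.
  by apply/nondecreasing_seqP => n; rewrite /series/= big_nat_recr//= lerDl.
by exists C => _ [n _ <-]; exact: aC.
Qed.

Lemma bounded_sum_shift (b : nat -> R) (C : R) (N n : nat) :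
  (forall n, 0 <= b n) -> (forall n, \sum_(0 <= i < n) b i <= C) ->
  \sum_(0 <= i < n) b (N + i)%N <= C.
Proof.
move=> b0 bC; apply: le_trans (bC (N + n)%N).
rewrite (@big_cat_nat _ _ _ N 0 (N + n))//= ?leq_addr//.
have -> : \sum_(N <= i < N + n) b i = \sum_(0 <= i < n) b (N + i)%N.
  by rewrite -{1}(add0n N) big_addn addKn; apply: eq_bigr => i _; rewrite addnC.
by rewrite lerDr sumr_ge0.
Qed.

(** A deterministic Robbins-Siegmund lemma: subtracting the partial sums of [b] makes [h]
    nonincreasing and bounded below by m - C, and telescoping bounds the sum of [a]. *)
Lemma almost_decreasing_cvg (h a b : nat -> R) (m C : R) :
  (forall n, 0 <= a n) -> (forall n, 0 <= b n) -> (forall n, m <= h n) ->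
  (forall n, \sum_(0 <= i < n) b i <= C) ->
  (forall n, h n.+1 <= h n - a n + b n) ->
  cvg (h @ \oo) /\ a @ \oo --> 0.
Proof.
move=> a0 b0 mh bC hS.
pose B n := \sum_(0 <= i < n) b i.
have BS n : B n.+1 = B n + b n by rewrite /B big_nat_recr.
have tele n : h n + \sum_(0 <= i < n) a i <= h 0%N + B n.
  elim: n => [|n IH]; first by rewrite !big_geq// /B big_geq.
  by rewrite BS big_nat_recr//=; have := hS n; lra.
split; last first.
  apply: (@cvg_bounded_sum a (h 0%N + C - m)) => // n.
  by have := tele n; have := mh n; have := bC n; rewrite /B; lra.
have cB : cvg (B @ \oo).
  apply: nondecreasing_is_cvgn.
    by apply/nondecreasing_seqP => n; rewrite BS lerDl.
  by exists C => _ [n _ <-]; exact: bC.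
have chB : cvg ((fun n => h n - B n) @ \oo).
  apply: nonincreasing_is_cvgn.
    by apply/nonincreasing_seqP => n; rewrite BS; have := hS n; have := a0 n; lra.
  exists (m - C) => _ [n _ <-].
  by have := mh n; have := bC n; rewrite /B; lra.
have -> : h = (fun n => (h n - B n) + B n) by apply/funext => n; rewrite subrK.
exact: is_cvgD.
Qed.

Lemma block_index (n : nat -> nat) (W k : nat) :
  n @ \oo --> \oo -> (n W <= k)%N ->
  exists w, (W <= w)%N /\ (n w <= k <= n w.+1)%N.
Proof.
move=> noo Wk.
have [w wk] : exists w, (W < w)%N && (k < n w)%N.
  have [N _ hN] : \forall w \near \oo, (k.+1 <= n w)%N.
    by move/cvgnyPge : noo; exact.
  by exists (maxn W.+1 N); rewrite leq_maxl /= hN//= leq_maxr.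
have [w' /andP[Ww kw] minw] := @ex_minnP (fun w => (W < w)%N && (k < n w)%N) (ex_intro _ w wk).
case: w' Ww kw minw => // w' Ww kw minw.
exists w'; split; first exact: Ww.
rewrite (ltnW kw) andbT leqNgt; apply/negP => kw'.
have [Ww'|] := ltnP W w'; last first.
  move=> w'W; have ww : w' = W by apply/eqP; rewrite eqn_leq w'W; exact: Ww.
  by move: kw'; rewrite ww ltnNge Wk.
by have := minw w'; rewrite Ww' kw' ltnn => /(_ isT).
Qed.

Lemma block_cvg (n : nat -> nat) (q u : nat -> R) (l : R) (W : nat) :
  n @ \oo --> \oo ->
  (forall w k, (W <= w)%N -> (n w <= k <= n w.+1)%N -> `|q k - l| <= u w) ->
  u @ \oo --> 0 -> q @ \oo --> l.
Proof.
move=> noo qu u0; apply/cvgrPdist_le => e e0.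
have /cvgr0Pnorm_le/(_ e e0)[W' _ hW'] := u0.
exists (n (maxn W W')) => //= k /= nk.
have [w [Ww kw]] := block_index noo nk.
rewrite distrC (le_trans (qu w k _ kw)) ?(leq_trans (leq_maxl _ _) Ww)//.
apply: le_trans (ler_norm _) _; apply: hW' => /=.
exact: leq_trans (leq_maxr _ _) Ww.
Qed.

(** [n w] is the first index at which the accumulated step size reaches T w. Once steps are at most
    T / 2, so is the overshoot, and block sums lie between T / 2 and 3 T / 2. *)
Lemma block_exists (alpha : nat -> R) (T : R) : 0 < T ->
  (forall k, 0 < alpha k) -> series alpha @ \oo --> +oo ->
  alpha @ \oo --> 0 ->
  exists n : nat -> nat, [/\ forall w, (n w <= n w.+1)%N, n @ \oo --> \oo &
    exists W, forall w, (W <= w)%N ->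
      T / 2 <= \sum_(n w <= i < n w.+1) alpha i <= 2 * T].
Proof.
move=> T0 alpha0 soo a0.
pose A n := \sum_(0 <= i < n) alpha i.
have Amono i j : (i <= j)%N -> A i <= A j.
  move=> ij; rewrite /A (@big_cat_nat _ _ _ i 0 j)//= lerDl sumr_ge0// => k _.
  exact: ltW.
have exA w : exists k, T * w%:R <= A k.
  have [N _ hN] : \forall k \near \oo, T * w%:R <= series alpha k.
    by move/cvgryPge : soo; exact.
  by exists N; exact: (hN N (leqnn N)).
pose n w := ex_minn (exA w).
have nP w : T * w%:R <= A (n w) by rewrite /n; case: ex_minnP.
have nmin w k : T * w%:R <= A k -> (n w <= k)%N.
  by rewrite /n; case: ex_minnP => m _; exact.
have nmono w : (n w <= n w.+1)%N.
  apply: nmin; apply: le_trans (nP w.+1).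
  by rewrite ler_pM2l// ler_nat.
have noo : n @ \oo --> \oo.
  apply/cvgnyPge => M.
  have [N NA] : exists N : nat, A M < T * N%:R.
    exists (Num.bound `|A M / T|).
    by rewrite mulrC -ltr_pdivrMr// (le_lt_trans (ler_norm _))// archi_boundP.
  exists N => //= w /= Nw; rewrite leqNgt; apply/negP => nM.
  have := nP w; rewrite leNgt => /negP; apply.
  apply: le_lt_trans (Amono _ _ (ltnW nM)) _; apply: (lt_le_trans NA).
  by rewrite ler_pM2l// ler_nat.
exists n; split => //.
have [K _ hK] : \forall k \near \oo, alpha k <= T / 2.
  have T2 : 0 < T / 2 by rewrite divr_gt0.
  have /cvgr0Pnorm_le/(_ _ T2) := a0; apply: filterS => k.
  by apply: le_trans (ler_norm _).
have [W _ hW] : \forall w \near \oo, (K.+1 <= n w)%N.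
  by move/cvgnyPge : noo; exact.
have up w : (W <= w)%N -> A (n w) <= T * w%:R + T / 2.
  move=> Ww; have := hW w Ww; case nw : (n w) => [//|k] /=; rewrite ltnS => Kk.
  have : A k < T * w%:R.
    by rewrite ltNge; apply/negP => /nmin; rewrite nw ltnn.
  by rewrite /A big_nat_recr//= -/(A k); have := hK k Kk; lra.
exists W => w Ww.
have -> : \sum_(n w <= i < n w.+1) alpha i = A (n w.+1) - A (n w).
  have -> : A (n w.+1) = A (n w) + \sum_(n w <= i < n w.+1) alpha i.
    by rewrite /A -big_cat_nat.
  by rewrite addrAC subrr add0r.
have h1 := nP w; have h2 := nP w.+1; have h3 := up w Ww.
have h4 := up w.+1 (leqW Ww).
by move: h2 h4; rewrite -natr1 mulrDr mulr1 => h2 h4; apply/andP; split; lra.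
Qed.

End RealSequences.

(** * Deterministic analysis of the recursion: drift, descent and convergence *)

Section NormalMapSequences.
Variables (R : realType) (d : nat).
Notation V := 'rV[R]_d.
Variables (z x e G F : nat -> V) (psi alpha : nat -> R) (lam L psimin : R).
Hypotheses (lam0 : 0 < lam) (L0 : 0 <= L) (alpha0 : forall k, 0 < alpha k).
Hypothesis FE : forall k, F k = G k + lam^-1 *: (z k - x k).
Hypothesis zS : forall k, z k.+1 = z k - alpha k *: (F k + e k).
Hypothesis firm : forall i j,
  enorm (x i - x j) ^+ 2 <= dotp (z i - z j) (x i - x j).
Hypothesis coprox : forall i j,
  enorm ((z i - x i) - (z j - x j)) <= enorm (z i - z j).
Hypothesis Glip : forall i j, enorm (G i - G j) <= L * enorm (x i - x j).
Hypothesis psi_up : forall i j, psi j - psi i <=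
  dotp (F i) (x j - x i) + lam^-1 * dotp (z j - z i) (x j - x i)
  - lam^-1 * enorm (x j - x i) ^+ 2 + L * enorm (x j - x i) ^+ 2.
Hypothesis psi_lb : forall k, psimin <= psi k.

Let K := L + lam^-1.
Let A m n := \sum_(m <= j < n) alpha j.
Let N m n := \sum_(m <= j < n) alpha j *: e j.

Let K0 : 0 < K.
Proof. by rewrite /K ltr_wpDl// invr_gt0. Qed.

Let A0 m n : 0 <= A m n.
Proof. by rewrite /A sumr_ge0// => k _; exact: ltW. Qed.

Let xlip i j : enorm (x i - x j) <= enorm (z i - z j).
Proof.
have [->|p0] := eqVneq (enorm (x i - x j)) 0; first exact: enorm_ge0.
rewrite -(@ler_pM2r _ (enorm (x i - x j))) ?lt_def ?p0 ?enorm_ge0//.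
by rewrite -expr2 (le_trans (firm i j))// dotp_le_enorm.
Qed.

(** The normal map is controlled by [z] rather than [x]: [L] enters through the nonexpansive map
    from z to x, and [lam^-1] through the nonexpansive map from z to z - x. *)
Lemma normal_map_lipschitz i j : enorm (F i - F j) <= K * enorm (z i - z j).
Proof.
have -> : F i - F j = (G i - G j) + lam^-1 *: ((z i - x i) - (z j - x j)).
  rewrite !FE; move: (G i) (G j) (z i) (z j) (x i) (x j) => *.
  by apply/rowP => k; rewrite !mxE; ring.
apply: le_trans (ler_enormD _ _) _; rewrite /K mulrDl lerD//.
  by apply: le_trans (Glip i j) _; rewrite ler_wpM2l.
by rewrite enormZ gtr0_norm ?invr_gt0// ler_wpM2l// invr_ge0 ltW.
Qed.

Lemma window_increment m i : (m <= i)%N ->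
  z i - z m + A m i *: F m =
  - \sum_(m <= j < i) alpha j *: (F j - F m) - N m i.
Proof.
move=> mi; rewrite -(subnK mi); elim: (i - m)%N => [|k IH].
  by rewrite add0n /A /N !big_geq// subrr scale0r !oppr0.
rewrite addSn /A /N !big_nat_recr ?leq_addl//=.
rewrite -/(A m (k + m)) -/(N m (k + m)) zS.
move: IH; set B := \sum_(m <= j < k + m) _; move: B (N _ _) (A _ _) => B N' A' IH.
have -> : B = - N' - (z (k + m)%N - z m + A' *: F m) by rewrite IH opprD opprK addrCA subrr addr0.
move: (z _) (z _) (F _) (F _) (e _) (alpha _) => *.
by apply/rowP => l; rewrite !mxE; ring.
Qed.

(** A bootstrap in place of a discrete Gronwall inequality. The bound [D] on |F j - F m| for earlier
    [j] reproduces itself at [i], because 2 K A <= 1 turns the accumulated drift A D into at most A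
    |F m| + s. *)
Lemma window_drift m n s : (m <= n)%N -> 0 <= s -> 2 * K * A m n <= 1 ->
  (forall i, (m <= i <= n)%N -> enorm (N m i) <= s) ->
  forall i, (m <= i <= n)%N ->
  [/\ enorm (z i - z m + A m i *: F m) <=
        2 * K * A m n ^+ 2 * enorm (F m) + 2 * s,
      enorm (z i - z m) <= 2 * (A m n * enorm (F m) + s) &
      enorm (F i - F m) <= 2 * K * (A m n * enorm (F m) + s)].
Proof.
move=> mn s0 KA Ns; elim/ltn_ind => i IH /andP[mi ni].
set D := 2 * K * (A m n * enorm (F m) + s).
have Fm0 := enorm_ge0 (F m); have S0 := A0 m n.
have SF0 : 0 <= A m n * enorm (F m) by rewrite mulr_ge0.
have D0 : 0 <= D.
  by apply: mulr_ge0; [rewrite mulr_ge0// ltW|exact: addr_ge0].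
have AiS : A m i <= A m n.
  by rewrite /A (@big_cat_nat _ _ _ i m n)//= lerDl -/(A i n).
have SD : A m n * D <= A m n * enorm (F m) + s.
  have -> : A m n * D = (2 * K * A m n) * (A m n * enorm (F m) + s).
    by rewrite /D; ring.
  by rewrite ler_piMl// addr_ge0.
have rle : enorm (z i - z m + A m i *: F m) <= A m n * D + s.
  rewrite window_increment//; apply: le_trans (ler_enormB _ _) _.
  rewrite enormN lerD ?Ns ?mi//; apply: le_trans (ler_enorm_sum _ _ _) _.
  apply: (@le_trans _ _ (A m i * D)); last by rewrite ler_wpM2r.
  rewrite /A mulr_suml !big_nat; apply: ler_sum => j /andP[mj ji].
  rewrite enormZ gtr0_norm// ler_wpM2l//; first exact: ltW.
  by have [|_ _] := IH j ji; rewrite ?mj ?(ltnW (leq_trans ji ni)).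
have zle : enorm (z i - z m) <= 2 * (A m n * enorm (F m) + s).
  have -> : z i - z m = (z i - z m + A m i *: F m) - A m i *: F m by rewrite addrK.
  apply: le_trans (ler_enormB _ _) _; rewrite enormZ ger0_norm//.
  by have := ler_wpM2r Fm0 AiS; lra.
split => //.
  apply: le_trans rle _.
  have -> : A m n * D + s =
     2 * K * A m n ^+ 2 * enorm (F m) + ((2 * K * A m n) * s + s).
    by rewrite /D; ring.
  by rewrite lerD2l; have := ler_wpM2r s0 KA; lra.
apply: le_trans (normal_map_lipschitz _ _) _.
by rewrite /D mulrAC [leRHS]mulrC ler_pM2l// mulrC.
Qed.

Let H tau k := psi k + tau * (lam / 2 * enorm (F k) ^+ 2).

Lemma window_descent tau m n s : (m <= n)%N -> 0 <= s -> 0 < A m n ->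
  0 < tau -> tau <= 1 / 4 -> tau * (lam * L) ^+ 2 <= 1 / 8 ->
  64 * (K * A m n) ^+ 2 <= tau -> 32 * lam * K ^+ 2 * A m n <= 1 ->
  (forall i, (m <= i <= n)%N -> enorm (N m i) <= s) ->
  H tau n <= H tau m - tau * A m n / 4 * enorm (F m) ^+ 2 + 14 / A m n * s ^+ 2.
Proof.
move=> mn s0 S0 tau0 tau4 tauL KS lKS Ns.
have KA : 2 * K * A m n <= 1.
  rewrite leNgt; apply/negP => h; have : 0 < K * A m n by rewrite mulr_gt0.
  by move: h KS; rewrite -mulrA; move: (K * _) => y *; nra.
have [|] := @window_drift m n s mn s0 KA Ns n; first by rewrite mn leqnn.
set r := z n - z m + _ => rle _ Fle.
pose dx := x n - x m; pose dz := z n - z m.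
have dzE : dz = - A m n *: F m + r.
  by rewrite scaleNr /r addrC addrK.
have Xb : enorm dx ^+ 2 <= dotp dz dx := firm n m.
have dFE : F n - F m = (G n - G m) + lam^-1 *: (dz - dx).
  rewrite !FE /dz /dx; move: (G _) (G _) (z _) (z _) (x _) (x _) => *.
  by apply/rowP => k; rewrite !mxE; ring.
(* The factor [lam] of the merit function cancels the [lam^-1] in [dFE]. The resulting
   [- dotp (F m) dx] merely lowers the coefficient of the same term of psi from 1 to 1 - tau. *)
have Fn : lam / 2 * enorm (F n) ^+ 2 - lam / 2 * enorm (F m) ^+ 2 =
    lam * dotp (F m) (G n - G m) + dotp (F m) dz - dotp (F m) dx
    + lam / 2 * enorm (F n - F m) ^+ 2.
  have Fsq := enorm_sqrD (F m) (F n - F m).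
  rewrite [F m + _]addrC subrK in Fsq; rewrite Fsq.
  have -> : dotp (F m) (F n - F m) = dotp (F m) (G n - G m) +
     lam^-1 * (dotp (F m) dz - dotp (F m) dx).
    by rewrite dFE !dotpE.
  by field; rewrite gt_eqF.
have dd : dotp (F m) (G n - G m) <= enorm (F m) * (L * enorm dx).
  apply: le_trans (dotp_le_enorm _ _) _.
  by rewrite ler_wpM2l ?enorm_ge0//; exact: Glip.
have c : dotp (F m) dz = - A m n * enorm (F m) ^+ 2 + dotp (F m) r.
  by rewrite dzE dotpDr dotpZr enorm_sqr.
have b : dotp dz dx = - A m n * dotp (F m) dx + dotp r dx.
  by rewrite dzE dotpDl dotpZl.
have := window_algebra lam0 L0 erefl S0 tau0 tau4 tauL KS lKS (enorm_ge0 (F m))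
  s0 (enorm_ge0 dx) (enorm_ge0 r) (enorm_ge0 (F n - F m)) c b Xb dd
  (dotp_le_enorm r dx) (dotp_le_enorm (F m) r) rle Fle.
rewrite -Fn; have := psi_up m n; rewrite -/dx -/dz /H.
move: (dotp _ _) (dotp _ _) (enorm dx ^+ 2) (enorm (F n) ^+ 2) => a b' X Fn2.
move: (enorm (F m) ^+ 2) (A m n) => Fm2 S h1 h2; lra.
Qed.

(** Carries the limit of psi from block ends to the indices inside. [psi_up] is one-sided, so it is
    applied in both directions, and the residual at [j] is then traded for the one at [i]. *)
Lemma psi_window_dist i j : `|psi j - psi i| <=
  (2 * enorm (F i) + enorm (F j - F i)) * enorm (z j - z i)
  + 2 * K * enorm (z j - z i) ^+ 2.
Proof.
have up a b : psi b - psi a <= enorm (F a) * enorm (z b - z a) +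
    2 * K * enorm (z b - z a) ^+ 2.
  apply: le_trans (psi_up a b) _.
  have Z0 := enorm_ge0 (z b - z a); have X0 := enorm_ge0 (x b - x a).
  have XZ := xlip b a; have l0 : 0 < lam^-1 by rewrite invr_gt0.
  have h1 : dotp (F a) (x b - x a) <= enorm (F a) * enorm (z b - z a).
    by apply: le_trans (dotp_le_enorm _ _) _; rewrite ler_wpM2l ?enorm_ge0.
  have h2 : dotp (z b - z a) (x b - x a) <= enorm (z b - z a) ^+ 2.
    by apply: le_trans (dotp_le_enorm _ _) _; rewrite expr2 ler_wpM2l.
  have h3 : enorm (x b - x a) ^+ 2 <= enorm (z b - z a) ^+ 2.
    by rewrite ler_pXn2r// nnegrE.
  have h4 := ler_wpM2l (ltW l0) h2; have h5 := ler_wpM2l L0 h3.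
  have h6 : 0 <= lam^-1 * enorm (x b - x a) ^+ 2 by rewrite mulr_ge0 ?sqr_ge0// ltW.
  have h7 : 0 <= L * enorm (z b - z a) ^+ 2 by rewrite mulr_ge0 ?sqr_ge0.
  have h8 : 0 <= lam^-1 * enorm (z b - z a) ^+ 2 by rewrite mulr_ge0 ?sqr_ge0// ltW.
  by rewrite /K; lra.
have Fj : enorm (F j) <= enorm (F i) + enorm (F j - F i).
  by apply: le_trans (ler_enormD _ _); rewrite addrC subrK.
have Z0 := enorm_ge0 (z j - z i).
have Fi0 := enorm_ge0 (F i); have D0 := enorm_ge0 (F j - F i).
have u1 := up i j; have u2 := up j i; rewrite (enorm_distC (z i)) in u2.
have h1 := ler_wpM2r Z0 Fj.
have h2 : 0 <= enorm (F i) * enorm (z j - z i) by rewrite mulr_ge0.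
have h3 : 0 <= enorm (F j - F i) * enorm (z j - z i) by rewrite mulr_ge0.
by rewrite ler_norml; apply/andP; split; lra.
Qed.

Lemma normal_map_cvg :
  (forall l : nat, exists (n : nat -> nat) (q : nat -> R) (C : R),
     [/\ forall w, (n w <= n w.+1)%N, n @ \oo --> \oo,
         exists W, forall w, (W <= w)%N ->
           l.+1%:R^-1 / 2 <= A (n w) (n w.+1) <= 2 * l.+1%:R^-1,
         forall w i, (n w <= i <= n w.+1)%N -> enorm (N (n w) i) ^+ 2 <= q w &
         forall W, \sum_(0 <= w < W) q w <= C]) ->
  (fun k => enorm (F k)) @ \oo --> 0 /\ cvg (psi @ \oo).
Proof.
move=> blocks; pose tau := (4 + 8 * (lam * L) ^+ 2)^-1.
have den0 : 0 < 4 + 8 * (lam * L) ^+ 2 by rewrite ltr_wpDr// mulr_ge0 ?sqr_ge0.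
have tau0 : 0 < tau by rewrite invr_gt0.
have tauE : tau * (4 + 8 * (lam * L) ^+ 2) = 1 by rewrite mulVf// gt_eqF.
have tll0 : 0 <= tau * (lam * L) ^+ 2 by rewrite mulr_ge0 ?sqr_ge0// ltW.
have tau4 : tau <= 1 / 4 by lra.
have tauL : tau * (lam * L) ^+ 2 <= 1 / 8 by lra.
(* Block sums are at most 2 T. The first entry yields K A <= tau / 8, hence 64 (K A)^2 <= tau^2 <=
   tau; the second yields 32 lam K^2 A <= 1. *)
pose T0 := Num.min (tau / (16 * K)) (64 * lam * K ^+ 2)^-1.
have T00 : 0 < T0 by rewrite lt_min divr_gt0 ?invr_gt0 ?mulr_gt0.
have [l lT0] : exists l : nat, l.+1%:R^-1 <= T0.
  have [l hl] : exists l : nat, T0^-1 < l%:R.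
    exists (Num.bound `|T0^-1|).
    exact: le_lt_trans (ler_norm _) (archi_boundP (normr_ge0 _)).
  exists l; rewrite -[T0]invrK lef_pV2 ?posrE ?ltr0n ?invr_gt0//.
  by rewrite ltW// (lt_trans hl)// ltr_nat.
have [n [q [C [nmono noo [W AW] Nq qC]]]] := blocks l.
set T := l.+1%:R^-1 in lT0 AW.
have T_gt0 : 0 < T by rewrite invr_gt0 ltr0n.
have q0 w : 0 <= q w.
  by apply: le_trans (Nq w (n w) _); rewrite ?sqr_ge0// leqnn nmono.
have small w : (W <= w)%N -> [/\ 0 < A (n w) (n w.+1),
    K * A (n w) (n w.+1) <= tau / 8 &
    32 * lam * K ^+ 2 * A (n w) (n w.+1) <= 1].
  move=> Ww; have /andP[lo hi] := AW w Ww; split; first by lra.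
    have : T <= tau / (16 * K) by apply: le_trans lT0 _; rewrite ge_min lexx.
    rewrite ler_pdivlMr ?mulr_gt0// => h.
    by have := ler_wpM2l (ltW K0) hi; lra.
  have : T <= (64 * lam * K ^+ 2)^-1.
    by apply: le_trans lT0 _; rewrite ge_min lexx orbT.
  have lK0 : 0 < 64 * lam * K ^+ 2 by rewrite !mulr_gt0.
  rewrite -(ler_pM2l lK0) mulfV ?gt_eqF// => h.
  have lK1 : 0 <= 32 * lam * K ^+ 2 by rewrite !mulr_ge0 ?sqr_ge0// ltW.
  by have := ler_wpM2l lK1 hi; lra.
have Ns w i : (n w <= i <= n w.+1)%N -> enorm (N (n w) i) <= Num.sqrt (q w).
  by move=> h; rewrite -(ger0_norm (enorm_ge0 _)) -sqrtr_sqr ler_wsqrtr// Nq.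
have KA2 w : (W <= w)%N -> 2 * K * A (n w) (n w.+1) <= 1.
  by move=> Ww; have [_ h _] := small w Ww; lra.
(* Indices are shifted to where A >= T / 2 holds, which turns tau A / 4 into tau T / 8 in [a] and 14
   / A into 28 / T in [b]. *)
pose h w := H tau (n (W + w)%N).
pose a w := tau * T / 8 * enorm (F (n (W + w)%N)) ^+ 2.
pose b w := 28 / T * q (W + w)%N.
have hstep w : h w.+1 <= h w - a w + b w.
  have Ww : (W <= W + w)%N by rewrite leq_addr.
  have [S0 KS lKS] := small _ Ww.
  have KS2 : 64 * (K * A (n (W + w)%N) (n (W + w).+1)) ^+ 2 <= tau.
    have : 0 < K * A (n (W + w)%N) (n (W + w).+1) by rewrite mulr_gt0.
    by move: KS; move: (K * _) => y *; nra.
  have := window_descent (nmono (W + w)%N) (sqrtr_ge0 (q (W + w)%N)) S0 tau0 tau4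
    tauL KS2 lKS (Ns (W + w)%N).
  rewrite -addnS (sqr_sqrtr (q0 _)) => /le_trans; apply.
  have /andP[lo hi] := AW _ Ww.
  rewrite /h /a /b addnS; apply: lerD.
    rewrite lerD2l lerN2 ler_wpM2r ?sqr_ge0//.
    by have := ler_wpM2l (ltW tau0) lo; lra.
  rewrite ler_wpM2r//.
  have TV : (T / 2)^-1 = 2 / T by rewrite invf_div.
  have : (A (n (W + w)%N) (n (W + w).+1))^-1 <= (T / 2)^-1.
    by rewrite lef_pV2 ?posrE ?divr_gt0.
  by rewrite TV; lra.
have [||||cvgh a_0] := @almost_decreasing_cvg R h a b psimin (28 / T * C) _ _ _ _ hstep.
- by move=> w; rewrite /a mulr_ge0 ?sqr_ge0// ltW// !mulr_gt0// invr_gt0.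
- by move=> w; rewrite /b mulr_ge0// ltW// divr_gt0.
- move=> w; rewrite /h /H; apply: le_trans (psi_lb (n (W + w)%N)) _.
  by rewrite lerDl (mulr_ge0 (ltW tau0))// mulr_ge0 ?sqr_ge0// divr_ge0// ltW.
- move=> w; rewrite /b -mulr_sumr ler_pM2l ?divr_gt0//.
  exact: bounded_sum_shift.
have q_0 : q @ \oo --> 0 by exact: (cvg_bounded_sum q0 qC).
have s_0 : (fun w => Num.sqrt (q w)) @ \oo --> 0.
  by rewrite -[X in _ --> X](@sqrtr0 R); apply: continuous_cvg => //; exact: sqrt_continuous.
have F2_0 : (fun w => enorm (F (n w)) ^+ 2) @ \oo --> 0.
  rewrite -(cvg_shiftn W).
  have -> : (fun w => enorm (F (n (w + W)%N)) ^+ 2) = (fun w => (tau * T / 8)^-1 * a w).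
    apply/funext => w; rewrite /a addnC mulrA mulVf ?mul1r//.
    by rewrite gt_eqF// divr_gt0// mulr_gt0.
  have c_0 : (fun w => (tau * T / 8)^-1 * a w) @ \oo --> (tau * T / 8)^-1 * 0.
    by apply: cvgM; [exact: cvg_cst|exact: a_0].
  by rewrite mulr0 in c_0.
have Fn_0 : (fun w => enorm (F (n w))) @ \oo --> 0.
  have -> : (fun w => enorm (F (n w))) = (fun w => Num.sqrt (enorm (F (n w)) ^+ 2)).
    by apply/funext => w; rewrite sqrtr_sqr ger0_norm// enorm_ge0.
  by rewrite -[X in _ --> X](@sqrtr0 R); apply: continuous_cvg => //; exact: sqrt_continuous.
(* With A <= 2 T, this dominates the quantity A |F| + s of [window_drift]. It tends to 0, so inner
   indices follow the start of their block. *)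
pose u w := 2 * T * enorm (F (n w)) + Num.sqrt (q w).
have u_0 : u @ \oo --> 0.
  rewrite -(addr0 0) -[X in X + _](mulr0 (2 * T)).
  by apply: cvgD => //; apply: cvgMr.
have bounds w k : (W <= w)%N -> (n w <= k <= n w.+1)%N ->
    enorm (z k - z (n w)) <= 2 * u w /\ enorm (F k - F (n w)) <= 2 * K * u w.
  move=> Ww kw.
  have [_ zb Fb] := window_drift (nmono w) (sqrtr_ge0 (q w)) (KA2 w Ww) (Ns w) kw.
  have /andP[lo hi] := AW _ Ww.
  have uE : A (n w) (n w.+1) * enorm (F (n w)) + Num.sqrt (q w) <= u w.
    by rewrite /u lerD2r ler_wpM2r ?enorm_ge0.
  split; first by apply: le_trans zb _; rewrite ler_pM2l.
  by apply: le_trans Fb _; rewrite ler_pM2l// mulr_gt0.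
have F_0 : (fun k => enorm (F k)) @ \oo --> 0.
  apply: (@block_cvg R n _ (fun w => enorm (F (n w)) + 2 * K * u w) 0 W noo).
    move=> w k Ww kw; rewrite subr0 ger0_norm ?enorm_ge0//.
    have [_ h2] := bounds w k Ww kw.
    apply: (@le_trans _ _ (enorm (F (n w)) + enorm (F k - F (n w)))).
      by apply: le_trans (ler_enormD _ _); rewrite addrC subrK.
    by rewrite lerD2l.
  rewrite -(addr0 0) -[X in _ + X](mulr0 (2 * K)).
  by apply: cvgD => //; apply: cvgMr.
split=> //.
have [lim_h hl] : exists l : R, h @ \oo --> l by exists (lim (h @ \oo)).
(* At block ends psi differs from the merit function by a multiple of |F|^2, already known to
   vanish. *)
have psin : (fun w => psi (n w)) @ \oo --> lim_h.
  rewrite -(cvg_shiftn W).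
  have -> : (fun w => psi (n (w + W)%N)) =
     (fun w => h w - tau * (lam / 2 * enorm (F (n (w + W)%N)) ^+ 2)).
    by apply/funext => w; rewrite /h /H addnC addrK.
  have t_0 : (fun w => tau * (lam / 2 * enorm (F (n (w + W)%N)) ^+ 2)) @ \oo -->
      tau * (lam / 2 * 0).
    apply: cvgM; [exact: cvg_cst|apply: cvgM; [exact: cvg_cst|]].
    by have := F2_0; rewrite -(cvg_shiftn W).
  have ht := cvgB hl t_0; rewrite !mulr0 subr0 in ht; exact: ht.
apply: (cvgP lim_h).
pose v w := (2 * enorm (F (n w)) + 2 * K * u w) * (2 * u w) + 2 * K * (2 * u w * (2 * u w)).
apply: (@block_cvg R n _ (fun w => v w + `|psi (n w) - lim_h|) lim_h W noo).
  move=> w k Ww kw.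
  have -> : psi k - lim_h = (psi k - psi (n w)) + (psi (n w) - lim_h).
    by rewrite addrA subrK.
  apply: le_trans (ler_normD _ _) _; rewrite lerD2r.
  apply: le_trans (psi_window_dist _ _) _.
  have [h1 h2] := bounds w k Ww kw.
  have Z0 := enorm_ge0 (z k - z (n w)).
  apply: lerD.
    rewrite ler_pM ?addr_ge0 ?enorm_ge0 ?lerD2l// mulr_ge0 ?enorm_ge0//.
  by rewrite ler_pM2l ?mulr_gt0// expr2 ler_pM.
have du_0 : (fun w => 2 * u w) @ \oo --> (2 * 0 : R).
  by apply: cvgM; [exact: cvg_cst|].
have v_0 : v @ \oo -->
    ((2 * 0 + 2 * K * 0) * (2 * 0) + 2 * K * (2 * 0 * (2 * 0)) : R).
  apply: cvgD; apply: cvgM => //.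
  - by apply: cvgD; apply: cvgM => //; exact: cvg_cst.
  - exact: cvg_cst.
  - exact: cvgM.
have d_0 : (fun w => `|psi (n w) - lim_h|) @ \oo --> `|lim_h - lim_h|.
  by apply: cvg_norm; apply: cvgB => //; exact: cvg_cst.
have vd := cvgD v_0 d_0.
by rewrite subrr normr0 !(mulr0, addr0) in vd; exact: vd.
Qed.

End NormalMapSequences.

(** * A pathwise maximal inequality for partial sums *)

Section RunningMaximum.
Variables (R : realType) (dlt : nat -> R).

Definition partial_sum n := \sum_(0 <= k < n) dlt k.

Fixpoint running_max n : R :=
  if n is k.+1 then Num.max (running_max k) `|partial_sum k.+1| else 0.

(** The running maximum times a subgradient of the absolute value at the current sum, with sign + at
    0. It depends only on the differences before index [n], so it is a predictable integrand. *)
Definition signed_max n :=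
  if partial_sum n < 0 then - running_max n else running_max n.

Lemma running_max_ge0 n : 0 <= running_max n.
Proof. by elim: n => //= n IH; rewrite le_max IH. Qed.

Lemma partial_sum_le_running_max n k :
  (k <= n)%N -> `|partial_sum k| <= running_max n.
Proof.
elim: n => [|n IH].
  by rewrite leqn0 => /eqP ->; rewrite /partial_sum big_geq//= normr0.
by rewrite leq_eqVlt => /predU1P[->|kn] /=; rewrite le_max ?lexx ?orbT// IH.
Qed.

(* Pathwise form of Doob's L2 maximal inequality: the last sum has zero
   expectation when dlt is a martingale difference sequence. *)
Lemma doob_pathwise n : running_max n ^+ 2 <=
  4 * \sum_(0 <= k < n) dlt k ^+ 2 +
  \sum_(0 <= k < n) (8 * partial_sum k - 4 * signed_max k) * dlt k.
Proof.
pose I n := \sum_(0 <= k < n) signed_max k * dlt k.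
have sumS k : partial_sum k.+1 = partial_sum k + dlt k.
  by rewrite /partial_sum big_nat_recr.
have sq : partial_sum n ^+ 2 =
    \sum_(0 <= k < n) dlt k ^+ 2 + \sum_(0 <= k < n) 2 * partial_sum k * dlt k.
  elim: n => [|n IH]; first by rewrite /partial_sum !big_geq// expr0n addr0.
  by rewrite sumS sqrrD IH !big_nat_recr//=; ring.
(* Induction: by convexity [I] grows by at most the old maximum times the increment of |sum|. If the
   old maximum a survives, the invariant persists; if |sum| = b exceeds it, at most -(b - a)^2 / 2
   remains. The claim is 4 [key] combined with 4 (max / 2 - |sum|)^2 >= 0. *)
have key : running_max n ^+ 2 / 2 - running_max n * `|partial_sum n| + I n <= 0.
  elim: n {sq} => [|n IH].
    by rewrite /I /partial_sum !big_geq//= expr0n normr0 mulr0 mul0r subr0 addr0.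
  rewrite /I big_nat_recr//= -/(I n).
  have a0 := running_max_ge0 n.
  have step : signed_max n * dlt n <=
      running_max n * (`|partial_sum n.+1| - `|partial_sum n|).
    rewrite /signed_max sumS; case: ltP => s0.
      rewrite mulNr -mulrN ler_wpM2l// (ltr0_norm s0).
      by rewrite -[`|_ + _|]normrN; have := ler_norm (- (partial_sum n + dlt n)); lra.
    rewrite ler_wpM2l// (ger0_norm s0).
    by have := ler_norm (partial_sum n + dlt n); lra.
  have b0 := normr_ge0 (partial_sum n.+1).
  move: step IH b0; move: (signed_max n * _) (I n) => J I'.
  move: `|partial_sum n.+1| `|partial_sum n| => b c step IH b0.
  case: (leP (running_max n) b) => [ab|/ltW ba].
    by have := sqr_ge0 (b - running_max n); nra.
  by nra.
have -> : \sum_(0 <= k < n) (8 * partial_sum k - 4 * signed_max k) * dlt k =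
    4 * \sum_(0 <= k < n) 2 * partial_sum k * dlt k - 4 * I n.
  rewrite /I !mulr_sumr -sumrB; apply: eq_bigr => k _; ring.
rewrite addrA -mulrDr -sq.
have : 0 <= (running_max n / 2 - `|partial_sum n|) ^+ 2 by exact: sqr_ge0.
have : `|partial_sum n| ^+ 2 = partial_sum n ^+ 2 by rewrite real_normK// num_real.
move: key; move: (partial_sum n ^+ 2) `|partial_sum n| => u v.
move=> h1 h2; rewrite -h2 sqrrB; move: h1; lra.
Qed.

End RunningMaximum.

Import HBNNSimple.

(** * Square-integrable functions and orthogonality to a sub-sigma-algebra *)

Section SquareIntegrable.
Context {dO : measure_display} {Omega : measurableType dO} {R : realType}.
Variable P : probability Omega R.
Implicit Types f g h Y : Omega -> R.

Definition sq_integrable f := measurable_fun setT f /\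
  P.-integrable setT (fun w => (f w ^+ 2)%:E).

Lemma sq_integrable_le f g : measurable_fun setT f -> sq_integrable g ->
  (forall w, `|f w| <= `|g w|) -> sq_integrable f.
Proof.
move=> mf [mg ig] fg; split => //.
apply: (le_integrable measurableT _ _ ig).
  by apply/measurable_EFinP; exact: measurable_funX.
move=> w _ /=; rewrite lee_fin !ger0_norm ?sqr_ge0//.
by rewrite -[f w ^+ 2]real_normK ?num_real// -[g w ^+ 2]real_normK ?num_real//
  ler_pXn2r ?nnegrE.
Qed.

Lemma sq_integrableZ (c : R) f : sq_integrable f ->
  sq_integrable (fun w => c * f w).
Proof.
move=> [mf jf]; split; first exact: measurable_funM.
have -> : (fun w => ((c * f w) ^+ 2)%:E) = (fun w => (c ^+ 2)%:E * (f w ^+ 2)%:E)%E.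
  by apply/funext => w; rewrite exprMn EFinM.
exact: integrableZl.
Qed.

Lemma sq_integrableD f g : sq_integrable f -> sq_integrable g ->
  sq_integrable (fun w => f w + g w).
Proof.
move=> [mf jf] [mg ig]; have mfg := measurable_funD mf mg; split => //.
have i2 : P.-integrable setT (fun w => 2%:E * (f w ^+ 2)%:E + 2%:E * (g w ^+ 2)%:E)%E.
  by apply: integrableD => //; exact: integrableZl.
apply: (le_integrable measurableT _ _ i2).
  by apply/measurable_EFinP; exact: measurable_funX.
move=> w _; rewrite -!EFinM -EFinD /= lee_fin.
rewrite [leLHS]ger0_norm ?sqr_ge0// (le_trans _ (ler_norm _))//.
by have := sqr_ge0 (f w - g w); nra.
Qed.

Lemma sq_integrableM f g : sq_integrable f -> sq_integrable g ->
  P.-integrable setT (fun w => (f w * g w)%:E).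
Proof.
move=> [mf jf] [mg ig].
have i2 : P.-integrable setT (fun w => (f w ^+ 2)%:E + (g w ^+ 2)%:E)%E.
  exact: integrableD.
apply: (le_integrable measurableT _ _ i2).
  by apply/measurable_EFinP; exact: measurable_funM.
move=> w _; rewrite -!EFinD /= lee_fin.
rewrite (le_trans _ (ler_norm _))// normrM.
rewrite -[f w ^+ 2]real_normK ?num_real// -[g w ^+ 2]real_normK ?num_real//.
by have := sqr_ge0 (`|f w| - `|g w|); have := sqr_ge0 (`|f w|);
  have := sqr_ge0 (`|g w|); nra.
Qed.

Lemma measurable_fun_sub_sigma (G : set (set Omega)) h : sub_sigma G ->
  measurable_fun setT (h : g_sigma_algebraType G -> R) -> measurable_fun setT h.
Proof.
move=> [sG Gm] mh _ B mB; apply: Gm; have := mh measurableT B mB.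
by rewrite measurable_g_measurableTypeE.
Qed.

(** The pull-out property of conditional expectation, stated through integrals over sets of [G]: it
    is clear for simple functions, and passes to [h] by dominated convergence with bound |h Y|. *)
Lemma integral_mul_orthogonal_ge0 (G : set (set Omega)) h Y : sub_sigma G ->
  measurable_fun setT (h : g_sigma_algebraType G -> R) ->
  (forall w, 0 <= h w) -> sq_integrable h -> sq_integrable Y ->
  P.-integrable setT (fun w => (Y w)%:E) ->
  (forall A, G A -> \int[P]_(w in A) (Y w)%:E = 0)%E ->
  (\int[P]_w (h w * Y w)%:E = 0)%E.
Proof.
move=> sG mh h0 Lh LY iY Y0.
have mhE : measurable_fun setT (fun w : g_sigma_algebraType G => (h w)%:E).
  exact/measurable_EFinP.
(* The approximation is taken on [Omega] equipped with [G], so that the level sets of [gn] lie in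
   [G], where [Y] integrates to 0. *)
pose gn := nnsfun_approx (@measurableT _ (g_sigma_algebraType G)) mhE.
have gn_cvg (w : Omega) : (fun n => gn n w) @ \oo --> h w.
  have := @cvg_nnsfun_approx _ _ _ _ (@measurableT _ (g_sigma_algebraType G)) _ mhE _ w I.
  move=> /(_ (fun w _ => h0 w)) /fine_cvg; exact.
have gn0 n w : 0 <= gn n w by [].
have gnh n w : gn n w <= h w.
  have := nondecreasing_cvgn_le _ (cvgP _ (gn_cvg w)) n.
  rewrite (cvg_lim _ (gn_cvg w))//; apply => i j ij.
  by have /lefP := nd_nnsfun_approx (@measurableT _ (g_sigma_algebraType G)) mhE ij; exact.
have mgn n : measurable_fun setT (gn n : Omega -> R).
  by apply: (measurable_fun_sub_sigma sG).
have [mY _] := LY.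
have zero n : (\int[P]_w (gn n w * Y w)%:E = 0)%E.
  pose S := finmap.enum_fset (fset_set (range (gn n))).
  have mA y : G (gn n @^-1` [set y]).
    have := @measurable_funPTI _ _ _ _ (gn n) [set y] (measurable_set1 y).
    by rewrite measurable_g_measurableTypeE//; exact: sG.1.
  have piece y : P.-integrable setT (fun w => (\1_(gn n @^-1` [set y]) w * Y w)%:E).
    apply: (le_integrable measurableT _ _ iY).
      apply/measurable_EFinP; apply: measurable_funM => //.
      exact: measurable_indic (sG.2 _ (mA y)).
    move=> w _ /=; rewrite lee_fin normrM ler_piMl// indicE.
    by case: (_ \in _); rewrite ?normr1 ?normr0.
  have piece0 y : (\int[P]_w (\1_(gn n @^-1` [set y]) w * Y w)%:E = 0)%E.
    rewrite -(Y0 _ (mA y)) [RHS]integral_mkcond; apply: eq_integral => w _.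
    by rewrite patchE indicE; case: ifP => _; rewrite ?mul1r ?mul0r.
  transitivity (\int[P]_w (\sum_(y <- S) (y%:E * (\1_(gn n @^-1` [set y]) w * Y w)%:E)))%E.
    apply: eq_integral => w _; rewrite [gn n w]fimfunE fsbig_finite//=.
    rewrite mulr_suml -sumEFin; apply: eq_bigr => y _.
    by rewrite -EFinM mulrA.
  rewrite integral_sum//; last by move=> y; exact: integrableZl.
  by apply: big1 => y _; rewrite integralZl// piece0 mule0.
have [|||||_ _] := @dominated_convergence _ _ _ P setT measurableT
    (fun n w => (gn n w * Y w)%:E) (fun w => (h w * Y w)%:E)
    (fun w => (`|h w * Y w|)%:E).
- by move=> n; apply/measurable_EFinP; exact: measurable_funM.
- by case/integrableP : (sq_integrableM Lh LY).
- by apply: aeW => w _; apply: cvg_EFin; [exact: nearW|apply: cvgMl].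
- by have := integrable_abse (sq_integrableM Lh LY).
- apply: aeW => w n _ /=; rewrite lee_fin !normrM ler_wpM2r//.
  by rewrite !ger0_norm.
under eq_fun do rewrite zero.
by move=> /(cvg_lim (@ereal_hausdorff R)) <-; rewrite lim_cst.
Qed.

Lemma integral_mul_orthogonal (G : set (set Omega)) h Y : sub_sigma G ->
  measurable_fun setT (h : g_sigma_algebraType G -> R) ->
  sq_integrable h -> sq_integrable Y ->
  P.-integrable setT (fun w => (Y w)%:E) ->
  (forall A, G A -> \int[P]_(w in A) (Y w)%:E = 0)%E ->
  (\int[P]_w (h w * Y w)%:E = 0)%E.
Proof.
move=> sG mh Lh LY iY Y0.
pose hp (w : Omega) := Num.max (h w) 0; pose hn (w : Omega) := Num.max (- h w) 0.
have mhp : measurable_fun setT (hp : g_sigma_algebraType G -> R).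
  exact: measurable_maxr.
have mhn : measurable_fun setT (hn : g_sigma_algebraType G -> R).
  by apply: measurable_maxr => //; exact: measurableT_comp.
have Lhp : sq_integrable hp.
  apply: (sq_integrable_le (measurable_fun_sub_sigma sG mhp) Lh) => w.
  by rewrite /hp; case: (leP (h w) 0) => _; rewrite ?normr0.
have Lhn : sq_integrable hn.
  apply: (sq_integrable_le (measurable_fun_sub_sigma sG mhn) Lh) => w.
  by rewrite /hn; case: (leP (- h w) 0) => _; rewrite ?normrN ?normr0.
have hE w : (h w * Y w)%:E = ((hp w * Y w)%:E - (hn w * Y w)%:E)%E.
  rewrite -EFinB -mulrBl /hp /hn; congr ((_ * _)%:E).
  by case: (leP (h w) 0); case: (leP (- h w) 0); lra.
under eq_integral do rewrite hE.
rewrite integralB//; [|exact: sq_integrableM|exact: sq_integrableM].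
rewrite !(integral_mul_orthogonal_ge0 sG)//; first by rewrite sube0.
- by move=> w; rewrite /hn le_max lexx orbT.
- by move=> w; rewrite /hp le_max lexx orbT.
Qed.

End SquareIntegrable.

(** * Doob's L2 maximal inequality for scalar martingale differences *)

Section DoobInequality.
Context {dO : measure_display} {Omega : measurableType dO} {R : realType}.
Variable P : probability Omega R.
Variable Fk : nat -> set (set Omega).
Hypothesis filtF : filtration Fk.

Local Notation measF k h :=
  (measurable_fun setT ((h : Omega -> R) : g_sigma_algebraType (Fk k) -> R)).

Lemma filtration_le i j : (i <= j)%N -> Fk i `<=` Fk j.
Proof.
move=> ij; rewrite -(subnK ij); elim: (j - i)%N => [//|k IH].
by apply: subset_trans IH _; rewrite addSn; case: (filtF (k + i)%N).
Qed.

Lemma filtration_measurable_fun i j (h : Omega -> R) :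
  (i <= j)%N -> measF i h -> measF j h.
Proof.
move=> ij mh _ B mB; have := mh measurableT B mB.
rewrite !measurable_g_measurableTypeE; first exact: filtration_le.
- by case: (filtF j) => -[].
- by case: (filtF i) => -[].
Qed.

Variable D : nat -> Omega -> R.
Hypothesis mD : forall k, measF k.+1 (D k).
Hypothesis LD : forall k, sq_integrable P (D k).
Hypothesis iD : forall k, P.-integrable setT (fun w => (D k w)%:E).
Hypothesis D0 : forall k A, Fk k A -> (\int[P]_(w in A) (D k w)%:E = 0)%E.

Variable m : nat.
Let dlt w k := D (m + k)%N w.

(** The first [n] differences stop at [D (m + n - 1)], which is measurable for [Fk (m + n)]: exactly
    the sigma-algebra on which the next difference [D (m + n)] has mean zero. *)
Let sum_meas n : measF (m + n) (fun w => partial_sum (dlt w) n) /\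
  sq_integrable P (fun w => partial_sum (dlt w) n).
Proof.
elim: n => [|n [mIH LIH]].
  have -> : (fun w => partial_sum (dlt w) 0) = (fun _ => 0).
    by apply/funext => w; rewrite /partial_sum big_geq.
  split; first exact: measurable_cst.
  split; first exact: measurable_cst.
  by under eq_fun do rewrite expr0n /=; exact: integrable0.
have -> : (fun w => partial_sum (dlt w) n.+1) =
    (fun w => partial_sum (dlt w) n + D (m + n)%N w).
  by apply/funext => w; rewrite /partial_sum big_nat_recr.
split; last exact: sq_integrableD.
apply: measurable_funD; last by rewrite addnS; exact: mD.
by apply: filtration_measurable_fun mIH; rewrite leq_add2l.
Qed.

Let max_meas n : measF (m + n) (fun w => running_max (dlt w) n) /\
  sq_integrable P (fun w => running_max (dlt w) n).
Proof.
elim: n => [|n [mIH LIH]].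
  split; first exact: measurable_cst.
  split; first exact: measurable_cst.
  by under eq_fun do rewrite expr0n /=; exact: integrable0.
have [mS LS] := sum_meas n.+1.
have mmax : measF (m + n.+1) (fun w => running_max (dlt w) n.+1).
  apply: measurable_maxr; last exact: measurableT_comp.
  by apply: filtration_measurable_fun mIH; rewrite leq_add2l.
have sF := (filtF (m + n.+1)).1.
have mSn : measF (m + n.+1) (fun w => `|partial_sum (dlt w) n.+1|).
  exact: measurableT_comp.
split=> //.
have Labs : sq_integrable P (fun w => `|partial_sum (dlt w) n.+1|).
  apply: sq_integrable_le LS _ => [|w]; last by rewrite normr_id.
  exact: (measurable_fun_sub_sigma sF mSn).
apply: sq_integrable_le (sq_integrableD LIH Labs) _.
  exact: (measurable_fun_sub_sigma sF mmax).
move=> w; have a0 := running_max_ge0 (dlt w) n.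
have b0 := normr_ge0 (partial_sum (dlt w) n.+1).
rewrite (ger0_norm (running_max_ge0 _ _)) ger0_norm ?addr_ge0//=.
by rewrite ge_max lerDl lerDr b0 a0.
Qed.

Let signed_meas n : measF (m + n) (fun w => signed_max (dlt w) n) /\
  sq_integrable P (fun w => signed_max (dlt w) n).
Proof.
have [mM LM] := max_meas n; have [mS _] := sum_meas n.
have sF := (filtF (m + n)).1.
have msg : measF (m + n) (fun w => signed_max (dlt w) n).
  apply: measurable_fun_ifT => //.
    by apply: measurable_fun_ltr => //; exact: measurable_cst.
  exact: measurableT_comp.
split=> //; apply: sq_integrable_le LM _ => [|w].
  exact: (measurable_fun_sub_sigma sF msg).
by rewrite /signed_max; case: ifP => _; rewrite ?normrN.
Qed.

(** The pathwise inequality is integrated. Each cross term is an [Fk (m + k)]-measurable coefficient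
    [c k] times a difference of mean zero on that sigma-algebra, so its integral vanishes. *)
Lemma doob_maximal n :
  (\int[P]_w (running_max (fun k => D (m + k)%N w) n ^+ 2)%:E <=
   \sum_(0 <= k < n) (4%:E * \int[P]_w (D (m + k)%N w ^+ 2)%:E))%E.
Proof.
pose c k w := 8 * partial_sum (dlt w) k - 4 * signed_max (dlt w) k.
have c_meas k : measF (m + k) (c k).
  apply: measurable_funB; apply: measurable_funM => //.
  - by case: (sum_meas k).
  - by case: (signed_meas k).
have cL k : sq_integrable P (c k).
  have -> : c k = (fun w => 8 * partial_sum (dlt w) k + - 4 * signed_max (dlt w) k).
    by apply/funext => w; rewrite /c mulNr.
  apply: sq_integrableD; apply: sq_integrableZ; first by case: (sum_meas k).
  by case: (signed_meas k).
have iDsq k : P.-integrable setT (fun w => 4%:E * (D (m + k)%N w ^+ 2)%:E)%E.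
  by apply: integrableZl => //; case: (LD (m + k)).
have icD k : P.-integrable setT (fun w => (c k w * D (m + k)%N w)%:E).
  exact: sq_integrableM.
pose r := index_iota 0 n.
have iS1 : P.-integrable setT
    (fun w => \sum_(k <- r) (4%:E * (D (m + k)%N w ^+ 2)%:E))%E.
  by apply: integrable_sum.
have iS2 : P.-integrable setT
    (fun w => \sum_(k <- r) (c k w * D (m + k)%N w)%:E)%E.
  by apply: integrable_sum.
apply: (@le_trans _ _ (\int[P]_w ((\sum_(k <- r) (4%:E * (D (m + k)%N w ^+ 2)%:E))
   + \sum_(k <- r) (c k w * D (m + k)%N w)%:E))%E).
  apply: ge0_le_integral => //.
  - by move=> w _; rewrite lee_fin sqr_ge0.
  - by have [_ [_ /integrableP[]]] := max_meas n.
  - by have /integrableP[] := integrableD measurableT iS1 iS2.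
  - move=> w _; under eq_bigr do rewrite -EFinM.
    rewrite !sumEFin -EFinD lee_fin -mulr_sumr.
    exact: (doob_pathwise (dlt w) n).
rewrite integralD// integral_sum// integral_sum//.
rewrite [X in (_ + X)%E]big1 ?adde0 => [|k _]; last first.
  apply: (integral_mul_orthogonal (filtF (m + k)).1 (c_meas k)) => //.
  exact: D0.
rewrite le_eqVlt; apply/orP; left; apply/eqP; apply: eq_bigr => k _.
by rewrite integralZl//; case: (LD (m + k)).
Qed.

End DoobInequality.

(** * Almost sure summability of the squared noise maxima over blocks *)

Section NoiseBlocks.
Context {dO : measure_display} {Omega : measurableType dO} {R : realType}.
Variable P : probability Omega R.
Variable d : nat.
Notation V := 'rV[R]_d.
Variables (Fk : nat -> set (set Omega)) (e : nat -> Omega -> V).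
Variables (alpha sigma : nat -> R) (C : R).
Hypothesis filtF : filtration Fk.
Hypothesis e_meas : forall k i,
  measurable_fun setT ((fun w => e k w ord0 i) : g_sigma_algebraType (Fk k.+1) -> R).
Hypothesis e_int : forall k i, P.-integrable setT (fun w => (e k w ord0 i)%:E).
Hypothesis e_mean : forall k i A, Fk k A ->
  (\int[P]_(w in A) (e k w ord0 i)%:E = 0)%E.
Hypothesis e_var : forall k,
  (\int[P]_w ((enorm (e k w)) ^+ 2)%:E <= ((sigma k) ^+ 2)%:E)%E.
Hypothesis sumC : forall n, \sum_(0 <= k < n) alpha k ^+ 2 * sigma k ^+ 2 <= C.

(** Maxima are taken coordinate by coordinate, so that the scalar inequality applies; the sum of
    their squares dominates the squared norm of every partial noise sum of the block. *)
Definition block_max (n : nat -> nat) (w : nat) (om : Omega) : R :=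
  \sum_(i < d) running_max
    (fun k => alpha (n w + k)%N * e (n w + k)%N om ord0 i) (n w.+1 - n w) ^+ 2.

Lemma block_max_ge (n : nat -> nat) w k om : (n w <= k <= n w.+1)%N ->
  enorm (\sum_(n w <= j < k) alpha j *: e j om) ^+ 2 <= block_max n w om.
Proof.
move=> /andP[nk kn]; rewrite enorm_sqr; apply: ler_sum => i _.
rewrite -expr2 -[leLHS]real_normK ?num_real// ler_pXn2r ?nnegrE ?running_max_ge0//.
have -> : (\sum_(n w <= j < k) alpha j *: e j om) ord0 i =
    partial_sum (fun k => alpha (n w + k)%N * e (n w + k)%N om ord0 i) (k - n w).
  rewrite summxE /partial_sum -{1}(add0n (n w)) big_addn.
  by apply: eq_bigr => j _; rewrite mxE addnC.
by apply: partial_sum_le_running_max; rewrite leq_sub2r.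
Qed.

Let e_coord_meas k i : measurable_fun setT (fun w => e k w ord0 i).
Proof. exact: (measurable_fun_sub_sigma (filtF k.+1).1 (@e_meas k i)). Qed.

Let e_coord_sq_int k i : P.-integrable setT (fun w => (e k w ord0 i ^+ 2)%:E).
Proof.
apply/integrableP; split.
  exact/measurable_EFinP/measurable_funX/e_coord_meas.
apply: (@le_lt_trans _ _ ((sigma k ^+ 2)%:E)); last exact: ltry.
apply: le_trans (e_var k); apply: ge0_le_integral => //.
- by apply: measurableT_comp => //; exact/measurable_EFinP/measurable_funX/e_coord_meas.
- apply/measurable_EFinP.
  have -> : (fun w => enorm (e k w) ^+ 2) = (fun w => \sum_(i < d) e k w ord0 i ^+ 2).
    by apply/funext => w; rewrite enorm_sqr; apply: eq_bigr => j _; rewrite expr2.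
  by apply: measurable_sum => j; exact/measurable_funX/e_coord_meas.
- move=> w _ /=; rewrite lee_fin ger0_norm ?sqr_ge0//.
  rewrite -[leLHS]real_normK ?num_real// ler_pXn2r ?nnegrE ?enorm_ge0//.
  exact: coord_le_enorm.
Qed.

Let D i k w := alpha k * e k w ord0 i.

Let D_meas i k : measurable_fun setT ((D i k) : g_sigma_algebraType (Fk k.+1) -> R).
Proof. by apply: measurable_funM => //; exact: e_meas. Qed.

Let D_sq i k : sq_integrable P (D i k).
Proof. by apply: sq_integrableZ; split; [exact: e_coord_meas|exact: e_coord_sq_int]. Qed.

Let D_int i k : P.-integrable setT (fun w => (D i k w)%:E).
Proof. by under eq_fun do rewrite EFinM; exact: integrableZl. Qed.

Let D_mean i k A : Fk k A -> (\int[P]_(w in A) (D i k w)%:E = 0)%E.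
Proof.
move=> FA; under eq_integral do rewrite EFinM.
have mA : measurable A by exact: (filtF k).1.2.
rewrite integralZl//; first by rewrite e_mean// mule0.
exact: integrableS (e_int k i).
Qed.

Let run_meas i (m l : nat) :
  measurable_fun setT (fun om => running_max (fun k => D i (m + k)%N om) l).
Proof.
elim: l => [|l IH]; first exact: measurable_cst.
apply: measurable_maxr => //; apply: measurableT_comp => //.
by apply: measurable_sum => k; apply: measurable_funM => //; exact: e_coord_meas.
Qed.

Let block_meas n w : measurable_fun setT (block_max n w).
Proof.
by apply: measurable_sum => i; exact/measurable_funX/run_meas.
Qed.

(** The squared coordinates of the noise add up to its squared norm, so the constant 4 acquires no
    factor of the dimension. *)
Lemma block_max_int (n : nat -> nat) w : (n w <= n w.+1)%N ->
  (\int[P]_om (block_max n w om)%:E <=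
   (4 * \sum_(n w <= k < n w.+1) alpha k ^+ 2 * sigma k ^+ 2)%:E)%E.
Proof.
move=> nw.
have mrun i : measurable_fun setT (fun om =>
   (running_max (fun k => D i (n w + k)%N om) (n w.+1 - n w) ^+ 2)%:E).
  exact/measurable_EFinP/measurable_funX/run_meas.
under eq_integral do rewrite /block_max -sumEFin.
rewrite ge0_integral_sum//; last by move=> i om _; rewrite lee_fin sqr_ge0.
apply: (@le_trans _ _ (\sum_(i < d) \sum_(0 <= k < n w.+1 - n w)
    (4%:E * \int[P]_om (D i (n w + k)%N om ^+ 2)%:E))%E).
  apply: lee_sum => i _.
  exact: (doob_maximal filtF (@D_meas i) (@D_sq i) (@D_int i) (@D_mean i)).
have -> : \sum_(n w <= k < n w.+1) alpha k ^+ 2 * sigma k ^+ 2 =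
    \sum_(0 <= k < n w.+1 - n w) alpha (n w + k)%N ^+ 2 * sigma (n w + k)%N ^+ 2.
  rewrite -{1}(add0n (n w)) big_addn.
  by apply: eq_bigr => k _; rewrite addnC.
rewrite exchange_big/= mulr_sumr -sumEFin; apply: lee_sum => k _.
move: (n w + k)%N => {k} k.
have -> : (\sum_(i < d) (4%:E * \int[P]_om (D i k om ^+ 2)%:E))%E =
    ((4 * alpha k ^+ 2)%:E * \int[P]_om (enorm (e k om) ^+ 2)%:E)%E.
  have -> : (\int[P]_om (enorm (e k om) ^+ 2)%:E =
      \sum_(i < d) \int[P]_om (e k om ord0 i ^+ 2)%:E)%E.
    rewrite -ge0_integral_sum//.
    - by apply: eq_integral => om _; rewrite sumEFin enorm_sqr /dotp.
    - by move=> i; exact/measurable_EFinP/measurable_funX/e_coord_meas.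
    - by move=> i om _; rewrite lee_fin sqr_ge0.
  rewrite ge0_sume_distrr//; last first.
    by move=> i _; apply: integral_ge0 => om _; rewrite lee_fin sqr_ge0.
  apply: eq_bigr => i _; rewrite EFinM -muleA; congr (_ * _)%E.
  under eq_integral do rewrite /D exprMn EFinM.
  by rewrite integralZl.
by rewrite mulrA (EFinM (4 * alpha k ^+ 2)) lee_wpmul2l// lee_fin mulr_ge0 ?sqr_ge0.
Qed.

Lemma ae_block_max_summable (n : nat -> nat) : (forall w, (n w <= n w.+1)%N) ->
  {ae P, forall om, exists C', forall W,
     \sum_(0 <= w < W) block_max n w om <= C'}.
Proof.
move=> nmono.
have q0 w om : (0 <= (block_max n w om)%:E)%E.
  by rewrite lee_fin sumr_ge0// => i _; exact: sqr_ge0.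
pose Q om := (\sum_(0 <= w <oo) (block_max n w om)%:E)%E.
have mq w : measurable_fun setT (fun om => (block_max n w om)%:E).
  exact/measurable_EFinP/block_meas.
have mQ : measurable_fun setT Q.
  by apply: ge0_emeasurable_sum.
have Q0 om : (0 <= Q om)%E by exact: nneseries_ge0.
have QC : (\int[P]_om Q om <= (4 * C)%:E)%E.
  rewrite integral_nneseries//.
  apply: lime_le.
    by apply: is_cvg_nneseries => w _ _; exact: integral_ge0.
  apply: nearW => W.
  apply: (@le_trans _ _ (\sum_(0 <= w < W)
      (4 * \sum_(n w <= k < n w.+1) alpha k ^+ 2 * sigma k ^+ 2)%:E)%E).
    by apply: lee_sum => w _; exact: block_max_int.
  rewrite sumEFin lee_fin -mulr_sumr ler_pM2l//.
  (* Consecutive blocks merge into one interval, whose sum is at most [C]. Hence the series [Q] has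
     finite integral and is finite almost everywhere. *)
  have -> : \sum_(0 <= w < W) \sum_(n w <= k < n w.+1) alpha k ^+ 2 * sigma k ^+ 2
    = \sum_(n 0%N <= k < n W) alpha k ^+ 2 * sigma k ^+ 2.
    elim: W => [|W IH]; first by rewrite !big_geq.
    rewrite big_nat_recr//= IH -big_cat_nat//.
    elim: W {IH} => // W IH; exact: leq_trans (nmono W).
  apply: le_trans (sumC (n W)).
  have n0W : (n 0 <= n W)%N.
    by elim: W => // W IH; exact: leq_trans (nmono W).
  rewrite (@big_cat_nat _ _ _ (n 0%N) 0 (n W))//= lerDr sumr_ge0// => k _.
  by rewrite mulr_ge0 ?sqr_ge0.
have iQ : P.-integrable setT Q.
  apply/integrableP; split => //.
  under eq_integral do rewrite gee0_abs//.
  by apply: le_lt_trans QC _; exact: ltry.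
apply: filterS (integrable_ae measurableT iQ) => om /(_ I) Qfin.
exists (fine (Q om)) => W; rewrite -lee_fin fineK// -sumEFin.
exact: nneseries_lim_ge.
Qed.

End NoiseBlocks.

(** * Measurability of compositions with a vector whose coordinates are measurable *)

Section MeasurableComposition.
Context {dO : measure_display} {Omega : measurableType dO} {R : realType}.
Variable d : nat.
Notation V := 'rV[R]_d.
Variable h : Omega -> V.
Hypothesis h_meas : forall i, measurable_fun setT (fun w => h w ord0 i).

(* An open set is a countable union of grid cells of mesh 1/(n+1). *)
Lemma measurable_open_preimage (O : set V) : open O -> measurable (h @^-1` O).
Proof.
move=> openO.
pose cell (p : nat * {ffun 'I_d -> int}) : set V :=
  [set v | forall i, v ord0 i * p.1.+1%:R \in `[(p.2 i)%:~R, (p.2 i)%:~R + 1[].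
pose E (p : nat * {ffun 'I_d -> int}) : set Omega :=
  if `[< cell p `<=` O >] then h @^-1` cell p else set0.
have -> : h @^-1` O = \bigcup_p E p.
  apply/seteqP; split=> [w Ow|w [p _]]; last first.
    by rewrite /E; case: asboolP => // pO; exact: pO.
  have /nbhs_normP[r /= r0 rO] : nbhs (h w) O by exact: open_nbhs_nbhs.
  have [n nr] : exists n : nat, r^-1 < n%:R.
    exists (Num.bound `|r^-1|).
    exact: le_lt_trans (ler_norm _) (archi_boundP (normr_ge0 _)).
  pose p := (n, [ffun i => Num.floor (h w ord0 i * n.+1%:R)]).
  have wp : cell p (h w).
    by move=> i; rewrite in_itv /= ffunE floor_le_tmp -intrD1 floorD1_gt.
  exists p => //; rewrite /E asboolT// => v vp; apply: rO => /=.
  change (mx_norm (h w - v) < r); rewrite mx_normrE.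
  apply: bigmax_lt => // -[i j] _ /=; rewrite (ord1 i) !mxE.
  have := wp j; have := vp j; rewrite !in_itv /= ffunE => /andP[a1 a2] /andP[b1 b2].
  have n0 : 0 < n.+1%:R :> R by rewrite ltr0n.
  rewrite -(ltr_pM2r n0) -[X in _ * X < _](gtr0_norm n0) -normrM mulrBl.
  apply: (@lt_trans _ _ 1); first by rewrite ltr_norml; apply/andP; split; lra.
  by rewrite -ltr_pdivrMl// mulr1 (lt_trans nr)// ltr_nat.
apply: countable_bigcupT_measurable; first exact: countableP.
move=> p; rewrite /E; case: asboolP => // _.
have -> : h @^-1` cell p = \bigcap_(i in [set: 'I_d])
    ((fun w => h w ord0 i * p.1.+1%:R) @^-1`
       [set` `[(p.2 i)%:~R, (p.2 i)%:~R + 1[ ]).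
  by apply/seteqP; split=> [w cw i _|w cw i]; [exact: cw|exact: cw].
apply: fin_bigcap_measurable => [|i _]; first exact: finite_finset.
rewrite -[X in measurable X]setTI.
have : measurable_fun setT (fun w => h w ord0 i * p.1.+1%:R).
  by apply: measurable_funM => //; exact: h_meas.
by apply => //; exact: measurable_itv.
Qed.

(** [O a] has to describe F > a only along the values of [h]. This allows intersecting with an open
    set that contains those values, as for an [f] that is regular only on [U]. *)
Lemma measurable_comp_open (F : Omega -> \bar R) (O : R -> set V) :
  (forall a, open (O a)) -> (forall w a, (a%:E < F w)%E <-> O a (h w)) ->
  measurable_fun setT F.
Proof.
move=> openO FO; apply: (measurability _ (ErealGenOInfty.measurableE R)).
move=> /= _ [_ [a ->]] <-; apply: measurableI => //.
rewrite preimage_itvoy.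
have -> : [set w | (a%:E < F w)%E] = h @^-1` O a.
  by apply/seteqP; split => w /=; rewrite FO.
exact: measurable_open_preimage.
Qed.

Lemma measurable_comp_continuous (g : V -> R) : continuous g ->
  measurable_fun setT (fun w => g (h w)).
Proof.
move=> cg; apply/measurable_EFinP.
apply: (@measurable_comp_open _ (fun a => g @^-1` [set t | a < t])).
  by move=> a; apply: open_comp => //; exact: open_gt.
by move=> w a; rewrite /= lte_fin.
Qed.

Lemma measurable_comp_lsc (g : V -> \bar R) : lower_semicontinuous g ->
  measurable_fun setT (fun w => g (h w)).
Proof.
move=> /lower_semicontinuousP lscg.
by apply: (@measurable_comp_open _ (fun a => [set v | (a%:E < g v)%E])).
Qed.

Lemma measurable_comp_differentiable (f : V -> R) (U : set V) : open U ->
  (forall v, U v -> differentiable f v) -> (forall w, U (h w)) ->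
  measurable_fun setT (fun w => f (h w)).
Proof.
move=> oU df Uh; apply/measurable_EFinP.
apply: (@measurable_comp_open _ (fun a => U `&` f @^-1` [set t | a < t])).
  move=> a; rewrite openE => v [Uv /= av]; apply: filterI.
    exact: open_nbhs_nbhs.
  have /differentiable_continuous cf := df v Uv.
  by apply: cf; apply: open_nbhs_nbhs; split => //; exact: open_gt.
by move=> w a; rewrite /= lte_fin; split => [|[]].
Qed.

End MeasurableComposition.

(** * The method along one sample path with finite Lipschitz modulus *)

Section Path.
Variables (R : realType) (d : nat).
Notation V := 'rV[R]_d.
Variables (phi : V -> \bar R) (f : V -> R) (U : set V) (lam : R).
Hypotheses (cphi : econvex phi) (lscphi : lower_semicontinuous phi).
Hypotheses (pphi : eproper phi) (C1f : C1_on f U) (domU : edom phi `<=` U).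
Hypothesis lam0 : 0 < lam.

Lemma econvex_segment_dom (a b : V) (t : R) : edom phi a -> edom phi b ->
  0 <= t -> t <= 1 -> edom phi (a + t *: (b - a)).
Proof.
move=> /= pa pb t0 t1.
have -> : a + t *: (b - a) = t *: b + (1 - t) *: a.
  by apply/rowP => i; rewrite !mxE; ring.
rewrite /edom/=; apply: le_lt_trans (cphi b a t0 t1) _.
have fa : phi a \is a fin_num by rewrite fin_numE pphi.1 lt_eqF.
have fb : phi b \is a fin_num by rewrite fin_numE pphi.1 lt_eqF.
by rewrite -(fineK fa) -(fineK fb) -!EFinM -EFinD ltry.
Qed.

Lemma finite_lip_segment_lipschitz (S : set V) :
  (ereal_sup [set lip (grad f) y | y in closure (conv_hull S)] < +oo)%E ->
  exists2 L : R, 0 <= L & forall a b (t : R), S a -> S b -> 0 <= t -> t <= 1 ->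
    enorm (grad f (a + t *: (b - a)) - grad f a) <= L * enorm (b - a).
Proof.
move=> supS.
(* [L] lies strictly above the supremum, so each point of the closed hull has a ball on which it is
   a Lipschitz constant. The supremum may be [-oo], for instance when d = 0 and no two points
   differ. *)
have [L L0 supL] : exists2 L : R, 0 <= L &
    (ereal_sup [set lip (grad f) y | y in closure (conv_hull S)] < L%:E)%E.
  move: supS; case: (ereal_sup _) => [r| |]// _.
    by exists (`|r| + 1); rewrite ?addr_ge0// lte_fin ltr_pwDr// ler_norm.
  by exists 0; rewrite ?ltNyr.
exists L => // a b t Sa Sb t0 t1.
have cE u : a + u *: ((a + t *: (b - a)) - a) = a + (u * t) *: (b - a).
  by apply/rowP => i; rewrite !mxE; ring.
apply: (@le_trans _ _ (L * enorm ((a + t *: (b - a)) - a))).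
  apply: segment_lipschitz => // u u0 u1; rewrite cE.
  apply: lip_lt_local => //; apply: le_lt_trans supL.
  apply: ereal_sup_ubound; exists (a + (u * t) *: (b - a)) => //.
  apply: subset_closure; apply: conv_hull_segment => //.
    by rewrite mulr_ge0.
  by rewrite mulr_ile1.
rewrite ler_wpM2l// addrC addKr enormZ ger0_norm//.
by rewrite ler_piMl ?enorm_ge0.
Qed.

Variables (alpha : nat -> R) (z x g e : nat -> V) (psibar : R).
Hypothesis alpha0 : forall k, 0 < alpha k.
Hypothesis zS :
  forall k, z k.+1 = z k - alpha k *: (g k + grad_env phi lam (z k)).
Hypothesis xE : forall k, x k = prox phi lam (z k).
Hypothesis eE : forall k, e k = g k - grad f (x k).
Hypothesis psi_lb : forall y, edom phi y -> (psibar%:E <= (f y)%:E + phi y)%E.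

Let psiR k := f (x k) + fine (phi (x k)).

Let phi_fin k : phi (x k) \is a fin_num.
Proof. by rewrite xE; exact: prox_fin_num. Qed.

Let x_dom k : edom phi (x k).
Proof. by rewrite /edom /= -(fineK (phi_fin k)) ltry. Qed.

(** With x k = prox (z k), the natural residual is a difference of two prox values whose arguments
    differ by exactly lam F_nor (z k). *)
Lemma Fnat_le_Fnor k :
  enorm (Fnat f phi lam (x k)) <= lam * enorm (Fnor f phi lam (z k)).
Proof.
rewrite /Fnat {1}xE.
apply: le_trans (prox_nonexpansive cphi lscphi pphi lam0 _ _) _.
rewrite -(gtr0_norm lam0) -enormZ (gtr0_norm lam0) /Fnor -xE.
rewrite le_eqVlt; apply/orP; left; apply/eqP; congr enorm.
rewrite scalerDr scalerA mulfV ?gt_eqF// scale1r.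
by rewrite opprB addrCA.
Qed.

Lemma normal_map_path :
  (ereal_sup [set lip (grad f) y
     | y in closure (conv_hull [set x k | k in [set: nat]])] < +oo)%E ->
  (forall l : nat, exists (n : nat -> nat) (q : nat -> R) (C : R),
     [/\ forall w, (n w <= n w.+1)%N, n @ \oo --> \oo,
         exists W, forall w, (W <= w)%N ->
           l.+1%:R^-1 / 2 <= \sum_(n w <= j < n w.+1) alpha j <= 2 * l.+1%:R^-1,
         forall w i, (n w <= i <= n w.+1)%N ->
           enorm (\sum_(n w <= j < i) alpha j *: e j) ^+ 2 <= q w &
         forall W, \sum_(0 <= w < W) q w <= C]) ->
  [/\ (fun k => Fnor f phi lam (z k)) @ \oo --> (0 : V),
      (fun k => Fnat f phi lam (x k)) @ \oo --> (0 : V) &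
      exists c : R, (fun k => (f (x k))%:E + phi (x k))%E @ \oo --> c%:E].
Proof.
move=> /finite_lip_segment_lipschitz[L L0 hL] blocks.
pose F k := Fnor f phi lam (z k).
have Sx k : [set x k | k in [set: nat]] (x k) by exists k.
have Glip i j : enorm (grad f (x i) - grad f (x j)) <= L * enorm (x i - x j).
  have := hL (x j) (x i) 1 (Sx j) (Sx i) ler01 (lexx 1).
  by rewrite scale1r [x j + _]addrC subrK.
have descent i j : f (x j) - f (x i) <=
    dotp (grad f (x i)) (x j - x i) + L * enorm (x j - x i) ^+ 2.
  apply: segment_descent => // t t0 t1; last exact: hL.
  apply: (C1f.2 _ _).1; apply: domU; exact: econvex_segment_dom.
have FE k : F k = grad f (x k) + lam^-1 *: (z k - x k) by rewrite /F /Fnor -xE.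
have zS' k : z k.+1 = z k - alpha k *: (F k + e k).
  rewrite zS FE eE /grad_env -xE; congr (_ - _ *: _).
  by rewrite [RHS]addrC addrA subrK.
(* The descent estimate for [f] starts at [x i], but the subgradient of [phi] is taken at the new
   point [x j]. Rewriting z j - x j through z i - x i ([h3]) produces the favourable term -|x j - x
   i|^2 / lam. *)
have psi_up i j : psiR j - psiR i <=
    dotp (F i) (x j - x i) + lam^-1 * dotp (z j - z i) (x j - x i)
    - lam^-1 * enorm (x j - x i) ^+ 2 + L * enorm (x j - x i) ^+ 2.
  have := prox_subgradient_fine cphi lscphi pphi lam0 (z j) (z i).
  rewrite -!xE -(opprB (x j) (x i)) dotpNr => h1; have h2 := descent i j.
  have -> : dotp (F i) (x j - x i) = dotp (grad f (x i)) (x j - x i) +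
      lam^-1 * dotp (z i - x i) (x j - x i) by rewrite FE dotpDl dotpZl.
  have h3 : dotp (z j - x j) (x j - x i) = dotp (z i - x i) (x j - x i) +
      dotp (z j - z i) (x j - x i) - enorm (x j - x i) ^+ 2.
    rewrite enorm_sqr -dotpDl -dotpNl -dotpDl; congr dotp.
    move: (z _) (z _) (x _) (x _) => *.
    by apply/rowP => k; rewrite !mxE; ring.
  rewrite h3 in h1; rewrite /psiR; move: h1 h2.
  move: (dotp _ _) (dotp _ _) (dotp _ _) (enorm _ ^+ 2) => A B C D.
  move: (f _) (f _) (fine _) (fine _) => *; lra.
have firm i j : enorm (x i - x j) ^+ 2 <= dotp (z i - z j) (x i - x j).
  by rewrite !xE; exact: prox_firm.
have coprox i j : enorm ((z i - x i) - (z j - x j)) <= enorm (z i - z j).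
  by rewrite !xE; exact: coprox_nonexpansive.
have psiR_lb k : psibar <= psiR k.
  by have := psi_lb (x_dom k); rewrite -(fineK (phi_fin k)) -EFinD lee_fin.
have [F0 cpsi] := normal_map_cvg lam0 L0 alpha0 FE zS' firm coprox Glip psi_up
  psiR_lb blocks.
split.
- by apply: cvg_enorm F0; apply: nearW => k.
- apply: (@cvg_enorm _ _ _ (fun k => lam * enorm (F k))).
    by apply: nearW => k; exact: Fnat_le_Fnor.
  have lF : (fun k => lam * enorm (F k)) @ \oo --> (lam * 0 : R).
    by apply: cvgM => //; exact: cvg_cst.
  by rewrite mulr0 in lF.
- exists (lim (psiR @ \oo)).
  have -> : (fun k => (f (x k))%:E + phi (x k))%E = (fun k => (psiR k)%:E).
    by apply/funext => k; rewrite /psiR EFinD fineK.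
  by apply: cvg_EFin => //; exact: nearW.
Qed.

End Path.

(** * Removing the weights from the summability condition *)

Section StepSizes.
Variable R : realType.

(** From [N] on, the weights are at least b N > 0, so the tail of the unweighted sum is at most the
    weighted one divided by [b N ^+ 2]. *)
Lemma weighted_sum_bounded (a b : nat -> R) : (forall k, 0 <= a k) ->
  (forall k, 0 < b k) -> (exists N, forall k, (N <= k)%N -> b k <= b k.+1) ->
  cvg (series (fun k => b k ^+ 2 * a k) @ \oo) ->
  exists C, forall n, \sum_(0 <= k < n) a k <= C.
Proof.
move=> a0 b0 [N bN] cs.
have bNk k : (N <= k)%N -> b N <= b k.
  move=> Nk; rewrite -(subnK Nk); elim: (k - N)%N => [//|m IH].
  by apply: le_trans IH _; rewrite addSn bN// leq_addl.
have ba0 k : 0 <= b k ^+ 2 * a k by rewrite mulr_ge0 ?sqr_ge0.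
have sB n : \sum_(0 <= k < n) b k ^+ 2 * a k <= limn (series (fun k => b k ^+ 2 * a k)).
  apply: (nondecreasing_cvgn_le _ cs).
  by apply/nondecreasing_seqP => m; rewrite /series/= big_nat_recr//= lerDl.
set B := limn _ in sB.
exists (\sum_(0 <= k < N) a k + (b N ^+ 2)^-1 * B) => n.
have bN2 : 0 < b N ^+ 2 by rewrite exprn_gt0.
apply: (@le_trans _ _ (\sum_(0 <= k < N + n) a k)).
  by rewrite (@big_cat_nat _ _ _ n 0 (N + n))//= ?leq_addl// lerDl sumr_ge0.
rewrite (@big_cat_nat _ _ _ N 0 (N + n))//= ?leq_addr// lerD2l.
rewrite -(ler_pM2l bN2) mulrA mulfV ?gt_eqF// mul1r.
apply: le_trans (sB (N + n)%N).
rewrite (@big_cat_nat _ _ _ N 0 (N + n))//= ?leq_addr// ler_wpDl ?sumr_ge0//.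
rewrite mulr_sumr !big_nat; apply: ler_sum => k /andP[Nk _].
by rewrite ler_wpM2r// ler_pXn2r ?nnegrE ?(ltW (b0 _))// bNk.
Qed.

End StepSizes.

(** * Measurability relative to a sub-sigma-algebra *)

Section MeasWrt.
Context {dO : measure_display} {Omega : measurableType dO} {R : realType}.
Variable d : nat.

Lemma meas_wrt_measurable_fun (G : set (set Omega)) (h : Omega -> 'rV[R]_d) i :
  sub_sigma G -> meas_wrt G h ->
  measurable_fun setT ((fun w => h w ord0 i) : g_sigma_algebraType G -> R).
Proof.
move=> [sG _] mh _ B mB; rewrite setTI measurable_g_measurableTypeE//.
exact: mh.
Qed.

End MeasWrt.

Unset Implicit Arguments.

Theorem theorem2p13
  (R : realType) (d : nat)
  (phi : 'rV[R]_d -> \bar R) (f : 'rV[R]_d -> R) (U : set 'rV[R]_d)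
  (dO : measure_display) (Omega : measurableType dO)
  (P : probability Omega R) (Fk : nat -> set (set Omega))
  (lam : R) (alpha : nat -> R) (z0 : 'rV[R]_d)
  (g z x : nat -> Omega -> 'rV[R]_d)
  (sigma beta : nat -> R) :
  (* phi convex, lsc, proper; f C^1 on an open set containing dom phi *)
  econvex phi -> lower_semicontinuous phi -> eproper phi ->
  C1_on f U -> edom phi `<=` U ->
  (* the method *)
  filtration Fk -> 0 < lam -> (forall k, 0 < alpha k) ->
  (forall w, z 0%N w = z0) ->
  (forall k w, z k.+1 w =
     z k w - alpha k *: (g k w + grad_env phi lam (z k w))) ->
  (forall k w, x k w = prox phi lam (z k w)) ->
  (forall k, meas_wrt (Fk k.+1) (g k)) ->
  (* (A.1) *)
  (exists psibar : R, forall y, edom phi y ->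
       (psibar%:E <= (f y)%:E + phi y)%E) ->
  (* (A.2) *)
  (forall k, cond_exp_eq P (Fk k) (g k) (fun w => grad f (x k w))) ->
  (forall k, 0 <= sigma k) ->
  (forall k, (\int[P]_w ((enorm (g k w - grad f (x k w))) ^+ 2)%:E
               <= ((sigma k) ^+ 2)%:E)%E) ->
  (* (A.3) *)
  series alpha @ \oo --> +oo -> alpha @ \oo --> 0 ->
  (* (A.4) *)
  (forall k, 0 < beta k) ->
  (exists N, forall k, (N <= k)%N -> beta k <= beta k.+1) ->
  cvg (series (fun k => alpha k ^+ 2 * beta k ^+ 2 * sigma k ^+ 2) @ \oo) ->
  (* conclusion *)
  exists psistar : Omega -> R,
    measurable_fun setT psistar /\
    {ae P, forall w,
       (ereal_sup [set lip (grad f) xb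
                   | xb in closure (conv_hull [set x k w | k in [set: nat]])]
          < +oo)%E ->
       (fun k => Fnor f phi lam (z k w)) @ \oo --> (0 : 'rV[R]_d) /\
       (fun k => Fnat f phi lam (x k w)) @ \oo --> (0 : 'rV[R]_d) /\
       (fun k => ((f (x k w))%:E + phi (x k w))%E) @ \oo --> (psistar w)%:E}.
Proof.
move=> cphi lscphi pphi C1f domU filtF lam0 alpha0 z_init zS xE g_meas.
move=> [psibar psi_lb] gmean sigma0 gvar soo a0 beta0 beta_mono betasum.
pose e k w := g k w - grad f (x k w).
have subF k : sub_sigma (Fk k) by case: (filtF k).
have x_dom k w : edom phi (x k w).
  by rewrite xE /edom /= -(fineK (prox_fin_num cphi lscphi pphi lam0 _)) ltry.
have e_meas k i :
    measurable_fun setT ((fun w => e k w ord0 i) : g_sigma_algebraType (Fk k.+1) -> R).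
  have -> : (fun w => e k w ord0 i) =
      (fun w => g k w ord0 i - grad f (x k w) ord0 i).
    by apply/funext => w; rewrite !mxE.
  apply: measurable_funB.
    exact: (meas_wrt_measurable_fun i (subF k.+1) (g_meas k)).
  (* As a conditional expectation the gradient is [Fk k]-measurable; it is lifted to [Fk k.+1],
     where [g k] lives. *)
  apply: (filtration_measurable_fun filtF (leqnSn k)).
  exact: (meas_wrt_measurable_fun i (subF k) (gmean k).1).
have e_int k i : P.-integrable setT (fun w => (e k w ord0 i)%:E).
  exact: ((gmean k).2 i).1.
have e_mean k i A : Fk k A -> (\int[P]_(w in A) (e k w ord0 i)%:E = 0)%E.
  exact: ((gmean k).2 i).2.
have [C sumC] : exists C, forall n,
    \sum_(0 <= k < n) alpha k ^+ 2 * sigma k ^+ 2 <= C.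
  apply: (@weighted_sum_bounded R _ beta) => //.
    by move=> k; rewrite mulr_ge0 ?sqr_ge0.
  have -> : (fun k => beta k ^+ 2 * (alpha k ^+ 2 * sigma k ^+ 2)) =
      (fun k => alpha k ^+ 2 * beta k ^+ 2 * sigma k ^+ 2).
    by apply/funext => k; ring.
  exact: betasum.
have z_meas k i : measurable_fun setT (fun w => z k w ord0 i).
  elim: k i => [|k IH] i.
    by under eq_fun do rewrite z_init; exact: measurable_cst.
  have -> : (fun w => z k.+1 w ord0 i) = (fun w => z k w ord0 i - alpha k *
      (g k w ord0 i + lam^-1 * (z k w ord0 i - prox phi lam (z k w) ord0 i))).
    by apply/funext => w; rewrite zS /grad_env !mxE.
  apply: measurable_funB => //; apply: measurable_funM => //.
  apply: measurable_funD.
    apply: (measurable_fun_sub_sigma (subF k.+1)).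
    exact: (meas_wrt_measurable_fun i (subF k.+1) (g_meas k)).
  apply: measurable_funM => //; apply: measurable_funB => //.
  apply: (measurable_comp_continuous IH (g := fun v => prox phi lam v ord0 i)) => v.
  apply: (@continuous_comp _ _ _ (prox phi lam) (fun v : 'rV[R]_d => v ord0 i)).
    exact: continuous_prox.
  exact: coord_continuous.
have x_meas k i : measurable_fun setT (fun w => x k w ord0 i).
  under eq_fun do rewrite xE.
  apply: (measurable_comp_continuous (z_meas k) (g := fun v => prox phi lam v ord0 i)) => v.
  apply: (@continuous_comp _ _ _ (prox phi lam) (fun v : 'rV[R]_d => v ord0 i)).
    exact: continuous_prox.
  exact: coord_continuous.
pose psi k w := ((f (x k w))%:E + phi (x k w))%E.
have psi_meas k : measurable_fun setT (psi k).
  apply: emeasurable_funD.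
    apply/measurable_EFinP; apply: (measurable_comp_differentiable (x_meas k) C1f.1).
      by move=> v Uv; exact: (C1f.2 v Uv).1.
    by move=> w; exact/domU/x_dom.
  exact: (measurable_comp_lsc (x_meas k) lscphi).
(* The upper limit is measurable on all of [Omega] and coincides with the limit wherever psi
   converges; [fine] supplies a real value elsewhere. *)
exists (fun w => fine (limn_esup (fun k => psi k w))); split.
  apply: (measurableT_comp (fine_measurable measurableT)).
  exact: measurable_fun_limn_esup.
have blocks_exist (l : nat) : exists n : nat -> nat,
    [/\ forall w, (n w <= n w.+1)%N, n @ \oo --> \oo &
      exists W, forall w, (W <= w)%N -> l.+1%:R^-1 / 2 <=
        \sum_(n w <= i < n w.+1) alpha i <= 2 * l.+1%:R^-1].
  by apply: block_exists => //; rewrite invr_gt0 ltr0n.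
(* The block boundaries for every [l] are fixed before any sample point, so the exceptional set is a
   countable union of null sets. *)
have [n nP] := choice blocks_exist.
have ae_sum : {ae P, forall w, forall l, exists C', forall W,
    \sum_(0 <= j < W) block_max e alpha (n l) j w <= C'}.
  apply: ae_foralln => l; have [nmono _ _] := nP l.
  exact: (ae_block_max_summable filtF e_meas e_int e_mean gvar sumC nmono).
apply: filterS ae_sum => w sumw lipw.
have blocks (l : nat) : exists (n : nat -> nat) (q : nat -> R) (C : R),
     [/\ forall w, (n w <= n w.+1)%N, n @ \oo --> \oo,
         exists W, forall w, (W <= w)%N ->
           l.+1%:R^-1 / 2 <= \sum_(n w <= j < n w.+1) alpha j <= 2 * l.+1%:R^-1,
         forall j i, (n j <= i <= n j.+1)%N ->
           enorm (\sum_(n j <= k < i) alpha k *: e k w) ^+ 2 <= q j &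
         forall W, \sum_(0 <= w < W) q w <= C].
  have [n1 n2 n3] := nP l; have [C' hC'] := sumw l.
  exists (n l), (fun j => block_max e alpha (n l) j w), C'; split => //.
  by move=> j i; exact: block_max_ge.
have [Fnor0 Fnat0 [c psic]] := normal_map_path cphi lscphi pphi C1f domU lam0
  alpha0 (fun k => zS k w) (fun k => xE k w) (fun k => erefl) psi_lb lipw blocks.
split=> //; split=> //.
have -> : limn_esup (fun k => psi k w) = c%:E.
  by rewrite is_cvg_limn_esupE; [exact/cvg_lim|apply/cvg_ex; exists c%:E].
exact: psic.
Qed.
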